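(* Let $\varphi: A\to B$ be a finite local morphism of Noetherian local rings such that $B/\mathfrak m_AB$ is a complete intersection, where $\mathfrak m_A$ is the maximal ideal of $A$. Let $k$ be the residue field of $A$. Let $M$ be a $B$-module which is of finite type over $A$. Assume that \[ \dim_k\operatorname{Tor}^A_1(M,k)\le(\operatorname{edim}(A)-\operatorname{edim}(B))\cdot\dim_k\operatorname{Tor}^A_0(M,k). \] Then $M$ is free over $B$, and \[ \dim_k\operatorname{Tor}^A_1(M,k)=(\operatorname{edim}(A)-\operatorname{edim}(B))\cdot\dim_k\operatorname{Tor}^A_0(M,k). \]
   Context: For a Noetherian local ring $A$, $\operatorname{edim}(A)$ is its embedding dimension, i.e. the minimal number of generators of its maximal ideal. $M$ is regarded as an $A$-module via $\varphi$. *)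

(* Defs.v *)
From HB Require Import structures.
From mathcomp Require Import all_boot all_order all_algebra.
From mathcomp Require Import boolp classical_sets.

Set Implicit Arguments.
Unset Strict Implicit.
Unset Printing Implicit Defensive.

Import Order.TTheory GRing.Theory Num.Theory.

Local Open Scope classical_set_scope.
Local Open Scope ring_scope.

(* Quotients, residue fields, completions, tensor products and Tor modules are
   handled up to isomorphism: a predicate says that a given object, with its
   structure maps, is the one in question. *)

(** * Modules *)

Section Modules.
Variables (R : comNzRingType) (V : lmodType R).

Definition span (X : set V) : set V :=
  [set x | exists n (c : 'I_n -> R) (g : 'I_n -> V),
     (forall i, X (g i)) /\ x = \sum_i c i *: g i].

Definition generated_by (N : set V) (n : nat) : Prop :=
  exists g : 'I_n -> V, N = span (range g).

Definition finitely_generated (N : set V) : Prop := exists n, generated_by N n.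

(* 0 when N is not finitely generated. *)
Definition min_generators (N : set V) : nat :=
  xget 0%N [set n | generated_by N n /\
                    forall m, generated_by N m -> (n <= m)%N].

Definition is_basis (I : choiceType) (b : I -> V) : Prop :=
  span (range b) = setT /\
  forall n (f : 'I_n -> I), injective f ->
  forall c : 'I_n -> R, \sum_i c i *: b (f i) = 0 -> forall i, c i = 0.

Definition free_module : Prop := exists (I : choiceType) (b : I -> V), is_basis b.

End Modules.

Definition finite_type (R : comNzRingType) (V : lmodType R) : Prop :=
  finitely_generated [set: V].

Definition restr (A B : comNzRingType) (phi : {rmorphism A -> B})
  (M : lmodType B) : Type := M.

Section Restriction.
Variables (A B : comNzRingType) (phi : {rmorphism A -> B}) (M : lmodType B).

HB.instance Definition _ := GRing.Zmodule.copy (restr phi M) M.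

Let scale (a : A) (x : restr phi M) : restr phi M := phi a *: (x : M).

Let scaleA a b x : scale a (scale b x) = scale (a * b) x.
Proof. by rewrite /scale scalerA rmorphM. Qed.

Let scale1 : left_id 1 scale.
Proof. by move=> x; rewrite /scale rmorph1 scale1r. Qed.

Let scaleDr : right_distributive scale +%R.
Proof. by move=> a x y; rewrite /scale scalerDr. Qed.

Let scaleDl x : {morph scale^~ x : a b / a + b}.
Proof. by move=> a b; rewrite /scale rmorphD scalerDl. Qed.

HB.instance Definition _ := GRing.Zmodule_isLmodule.Build A (restr phi M)
  scaleA scale1 scaleDr scaleDl.

End Restriction.

(** * Ideals and local rings *)

Section Ideals.
Variable R : comNzRingType.
Implicit Types I J m : set R.

Definition ideal I : Prop :=
  [/\ I 0, forall x y, I x -> I y -> I (x + y) & forall a x, I x -> I (a * x)].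

Definition ideal_gen (X : set R) : set R := @span R R^o X.

Definition ideal_mul I J : set R :=
  ideal_gen [set z | exists x y, [/\ I x, J y & z = x * y]].

Definition ideal_pow I (n : nat) : set R := iter n (ideal_mul I) setT.

Definition prime_ideal I : Prop :=
  [/\ ideal I, ~ I 1 & forall x y, I (x * y) -> I x \/ I y].

Definition maximal_ideal m : Prop :=
  [/\ ideal m, ~ m 1 & forall I, ideal I -> ~ I 1 -> m `<=` I -> I = m].

Definition noetherian : Prop :=
  forall I, ideal I -> @finitely_generated R R^o I.

(* R is local with maximal ideal m *)
Definition local_ring m : Prop :=
  maximal_ideal m /\ forall m', maximal_ideal m' -> m' = m.

Definition noetherian_local m : Prop := noetherian /\ local_ring m.

Definition edim m : nat := @min_generators R R^o m.

Definition prime_chain (p : nat -> set R) (n : nat) : Prop :=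
  (forall i, (i <= n)%N -> prime_ideal (p i)) /\
  (forall i, (i < n)%N -> p i `<` p i.+1).

Definition has_krull_dim (n : nat) : Prop :=
  (exists p, prime_chain p n) /\ forall p n', prime_chain p n' -> (n' <= n)%N.

Definition regular_local m : Prop :=
  noetherian_local m /\ has_krull_dim (edim m).

Definition regular_sequence (s : seq R) : Prop :=
  ~ ideal_gen [set` s] 1 /\
  forall i, (i < size s)%N -> forall y,
    ideal_gen [set` take i s] (s`_i * y) -> ideal_gen [set` take i s] y.

End Ideals.

Definition is_quotient_by (R Q : comNzRingType) (I : set R)
    (p : {rmorphism R -> Q}) : Prop :=
  (forall y, exists x, p x = y) /\ forall x, p x = 0 <-> I x.

(* A sequence u with u (n + 1) = u n modulo m ^ n for all n represents an element
   of the inverse limit of the R / m ^ n. *)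
Definition coherent (R : comNzRingType) (m : set R) (u : nat -> R) : Prop :=
  forall n, ideal_pow m n (u n.+1 - u n).

(* C is the inverse limit of the R / m ^ n: lim identifies C with the ring of
   coherent sequences modulo those with u n in m ^ n for all n. *)
Definition is_completion (R : comNzRingType) (m : set R)
    (C : comNzRingType) : Prop :=
  exists lim : (nat -> R) -> C,
    [/\ forall u v, coherent m u -> coherent m v ->
          lim (fun n => u n + v n) = lim u + lim v,
        forall u v, coherent m u -> coherent m v ->
          lim (fun n => u n * v n) = lim u * lim v,
        lim (fun=> 1) = 1,
        forall z, exists2 u, coherent m u & lim u = z
      & forall u, coherent m u -> lim u = 0 <-> forall n, ideal_pow m n (u n)].

(* The completion of R is a regular local ring modulo a regular sequence. *)
Definition complete_intersection (R : comNzRingType) : Prop :=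
  exists m : set R, noetherian_local m /\
  exists (C S : comNzRingType) (mS : set S) (s : seq S) (p : {rmorphism S -> C}),
    [/\ is_completion m C, regular_local mS, regular_sequence s
      & is_quotient_by (ideal_gen [set` s]) p].

Definition local_morphism (A B : comNzRingType) (mA : set A) (mB : set B)
    (phi : {rmorphism A -> B}) : Prop :=
  forall x, mA x -> mB (phi x).

Definition finite_morphism (A B : comNzRingType)
    (phi : {rmorphism A -> B}) : Prop :=
  finite_type (restr phi B^o).

(** * Tor *)

Section Tor.
Variable R : comNzRingType.

Definition is_tensor (M N T : lmodType R) (t : {bilinear M -> N -> T}) : Prop :=
  forall (L : lmodType R) (f : {bilinear M -> N -> L}),
    exists g : {linear T -> L},
      (forall x y, g (t x y) = f x y) /\
      forall g' : {linear T -> L}, (forall x y, g' (t x y) = f x y) -> g' =1 g.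

Definition projective (P : lmodType R) : Prop :=
  forall (X Y : lmodType R) (p : {linear X -> Y}) (f : {linear P -> Y}),
    (forall y, exists x, p x = y) ->
    exists g : {linear P -> X}, forall x, p (g x) = f x.

Definition exact_at (X Y Z : lmodType R) (f : X -> Y) (g : Y -> Z) : Prop :=
  forall y, g y = 0 <-> exists x, f x = y.

Definition projective_resolution (M : lmodType R) (P : nat -> lmodType R)
    (d : forall n, {linear P n.+1 -> P n}) (e : {linear P 0 -> M}) : Prop :=
  [/\ forall n, projective (P n), forall y, exists x, e x = y,
      exact_at (d 0) e & forall n, exact_at (d n.+1) (d n)].

Definition cycles (Q : nat -> lmodType R)
    (d : forall n, {linear Q n.+1 -> Q n}) (n : nat) : set (Q n) :=
  match n return set (Q n) with
  | 0 => setT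
  | n'.+1 => [set x | d n' x = 0]
  end.

(* h identifies T with the cycles modulo the boundaries in degree n; its values
   outside the cycles are irrelevant. *)
Definition is_homology (Q : nat -> lmodType R)
    (d : forall n, {linear Q n.+1 -> Q n}) (n : nat) (T : lmodType R) : Prop :=
  exists h : Q n -> T,
    [/\ forall a x y, cycles d x -> cycles d y -> h (a *: x + y) = a *: h x + h y,
        forall z, exists2 x, cycles d x & h x = z
      & forall x, cycles d x -> h x = 0 <-> exists y, d n y = x].

(* T is Tor_n^R(M, N) *)
Definition is_Tor (n : nat) (M N T : lmodType R) : Prop :=
  exists (P : nat -> lmodType R) (d : forall i, {linear P i.+1 -> P i})
         (e : {linear P 0 -> M})
         (Q : nat -> lmodType R) (t : forall i, {bilinear P i -> N -> Q i})
         (dQ : forall i, {linear Q i.+1 -> Q i}),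
    [/\ projective_resolution d e, forall i, is_tensor (t i),
        forall i x y, dQ i (t i.+1 x y) = t i (d i x) y
      & is_homology dQ n T].

End Tor.

(* For p : A -> k onto and T = Tor_n^A(M, k), the k-structure of T coming from
   the second argument is the unique one inducing its A-module structure along p;
   hence T has dimension d iff it is A-isomorphic to k^d. The value is 0 when T
   is not of this form. *)
Definition dim_over (A : comNzRingType) (k : fieldType) (p : {rmorphism A -> k})
    (T : lmodType A) : nat :=
  xget 0%N [set d | exists g : {linear T -> restr p 'rV[k]_d}, bijective g].

(* Main.v *)
(** Idea.  Write J = m_A B, N = M / JM, e = edim A and f = edim B.  Since B/J is a
    complete intersection with at most f generators of its maximal ideal, J is
    generated by f relations g_l, so JM / J^2 M has length at most f times that of
    N.  Comparing with a minimal presentation of M over A modulo m_A^2 gives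
    dim Tor_1 >= (e - f) dim Tor_0.  In the case of equality, sum_l g_l u_l lies in
    J^2 M only if all u_l lie in JM.

    Write g = a x with x generating m_B, and let Delta = det a, which generates the
    socle of B/J.  Descending through the exterior powers of the Koszul complex of
    x, that injectivity shows that Delta v in JM implies v in m_B M; hence a
    relation between minimal generators of N would involve the socle, and N is free
    over B/J.  The equality of dimensions then lifts freeness to M.

    The socle statement is proved for S/(s), with S regular of dimension d, by
    comparing the Koszul complex of the generators of m_S with the regular sequence
    s; this needs that s has length d, which follows from Krull's height theorem. *)

Require Import Defs.
From HB Require Import structures.
From mathcomp Require Import all_boot all_order all_algebra.
From mathcomp Require Import boolp classical_sets.
From mathcomp Require Import generic_quotient ring zify.

Set Implicit Arguments.
Unset Strict Implicit.
Unset Printing Implicit Defensive.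

Import Order.TTheory GRing.Theory Num.Theory.

Local Open Scope classical_set_scope.
Local Open Scope ring_scope.

(** * Linear algebra over a commutative ring *)

(** The hypothesis on B/J concerns its completion, but B/J is finite over k, so a power of m_B lies
    in J, the completion is B/J itself, and B/J is a quotient S/(s). What this gives for generators
    of m_S must be moved to the images of f minimal generators of m_B, because the count needs
    exactly f relations; these images may be redundant in B/J, so non-minimal generating systems
    have to be allowed. The count takes place in m_A A^b0 / m_A^2 A^b0, where b0 = dim Tor_0.
    Equality yields, besides the injectivity statement, that K ∩ m_A^2 A^b0 lies in m_A K, K being
    the kernel of A^b0 -> M. This second fact is what lifts freeness: with r minimal generators of M
    over B, the kernel of B^r -> M lies in J^2 B^r, hence in m_A times itself, and Nakayama's lemma
    kills it. *)

Definition idealization (R : comNzRingType) (V : lmodType R) : Type := (R * V)%type.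

Section Idealization.
Variables (R : comNzRingType) (V : lmodType R).
Local Notation E := (idealization V).
HB.instance Definition _ := GRing.Zmodule.on E.

Let mul (p q : E) : E := (p.1 * q.1, p.1 *: q.2 + q.1 *: p.2).
Let one : E := (1, 0).

Fact idealization_mulA : associative mul.
Proof.
move=> [a x] [b y] [c z]; rewrite /mul /= mulrA !scalerDr !scalerA addrA.
by rewrite [c * a]mulrC [c * b]mulrC.
Qed.
Fact idealization_mulC : commutative mul.
Proof. by move=> [a x] [b y]; rewrite /mul /= mulrC addrC. Qed.
Fact idealization_mul1 : left_id one mul.
Proof. by move=> [a x]; rewrite /mul /= mul1r scale1r scaler0 addr0. Qed.
Fact idealization_mulDl : left_distributive mul +%R.
Proof.
move=> [a x] [b y] [c z]; rewrite /mul /=; congr (_, _) => /=; first exact: mulrDl.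
by rewrite /= scalerDl scalerDr addrACA.
Qed.
Fact idealization_one_neq0 : one != 0.
Proof. by rewrite xpair_eqE oner_eq0. Qed.
HB.instance Definition _ := GRing.Zmodule_isComNzRing.Build E
  idealization_mulA idealization_mulC idealization_mul1 idealization_mulDl
  idealization_one_neq0.

Definition ideal_vec (x : V) : E := (0, x).
Definition ideal_scal (a : R) : E := (a, 0).

Fact ideal_scal_additive : zmod_morphism ideal_scal.
Proof. by move=> x y; congr (_, _); rewrite /= subr0. Qed.
HB.instance Definition _ :=
  GRing.isZmodMorphism.Build R E ideal_scal ideal_scal_additive.
Fact ideal_scal_mult : monoid_morphism ideal_scal.
Proof. by split=> // a b; congr (_, _); rewrite /= !scaler0 addr0. Qed.
HB.instance Definition _ :=
  GRing.isMonoidMorphism.Build R E ideal_scal ideal_scal_mult.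

Lemma ideal_vecZ a x : ideal_vec (a *: x) = ideal_scal a * ideal_vec x.
Proof. by congr (_, _); rewrite /= ?mulr0 // scaler0 addr0. Qed.

Lemma ideal_vecD x y : ideal_vec (x + y) = ideal_vec x + ideal_vec y.
Proof. by congr (_, _); rewrite /= addr0. Qed.

Lemma ideal_vecN x : ideal_vec (- x) = - ideal_vec x.
Proof. by congr (_, _); rewrite /= oppr0. Qed.

Lemma ideal_vec0 : ideal_vec 0 = 0. Proof. by []. Qed.

Lemma ideal_vec_inj : injective ideal_vec. Proof. by move=> x y []. Qed.

End Idealization.

(* Module identities become ring identities in the square-zero extension. *)
Ltac module :=
  apply: ideal_vec_inj;
  rewrite ?(ideal_vecD, ideal_vecN, ideal_vec0, ideal_vecZ); ring.

(* Not the [span] of MathComp's vector spaces. *)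
Local Notation span := (@Defs.span _ _).

Section Submodules.
Variables (R : comNzRingType) (V : lmodType R).
Implicit Types (U W X : set V) (I : set R).

Definition submod U : Prop :=
  [/\ U 0, forall x y, U x -> U y -> U (x + y) & forall a x, U x -> U (a *: x)].

Definition smul I U : set V :=
  span [set z | exists a x, [/\ I a, U x & z = a *: x]].

Lemma submod0 U : submod U -> U 0. Proof. by case. Qed.

Lemma submodD U x y : submod U -> U x -> U y -> U (x + y).
Proof. by case=> _ + _; apply. Qed.

Lemma submodZ U a x : submod U -> U x -> U (a *: x).
Proof. by case=> _ _; apply. Qed.

Lemma submodN U x : submod U -> U x -> U (- x).
Proof. by move=> sU Ux; rewrite -scaleN1r; apply: submodZ. Qed.

Lemma submodB U x y : submod U -> U x -> U y -> U (x - y).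
Proof. by move=> sU Ux Uy; apply: submodD => //; apply: submodN. Qed.

Lemma submod_sum U (T : Type) (r : seq T) (P : pred T) (F : T -> V) :
  submod U -> (forall i, P i -> U (F i)) -> U (\sum_(i <- r | P i) F i).
Proof.
by move=> sU UF; apply: big_ind => //; [case: sU | move=> *; apply: submodD].
Qed.

Lemma submod_eqm U x y : submod U -> U (x - y) -> U x <-> U y.
Proof.
move=> sU Uxy; split=> h; last by rewrite -(subrK y x); apply: submodD.
by rewrite -(subKr x y); apply: submodB.
Qed.

Lemma submodT : submod setT. Proof. by []. Qed.

Lemma submodI U W : submod U -> submod W -> submod (U `&` W).
Proof.
move=> sU sW; split; first by split; apply: submod0.
- by move=> x y [? ?] [? ?]; split; apply: submodD.
- by move=> a x [? ?]; split; apply: submodZ.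
Qed.

Lemma sub_span X : X `<=` span X.
Proof.
by move=> x Xx; exists 1%N, (fun=> 1), (fun=> x); rewrite big_ord1 scale1r.
Qed.

Lemma span_min X U : submod U -> X `<=` U -> span X `<=` U.
Proof.
move=> sU XU _ [n [c [g [Xg ->]]]].
by apply: submod_sum => // i _; apply: submodZ => //; apply: XU.
Qed.

Lemma span_submod X : submod (span X).
Proof.
split.
- by exists 0%N, (fun=> 0), (fun=> 0); split; [case | rewrite big_ord0].
- move=> _ _ [n [c [g [Xg ->]]]] [p [d [h [Xh ->]]]].
  pose F A (u : 'I_n -> A) (v : 'I_p -> A) i :=
    match split i with inl j => u j | inr j => v j end.
  exists (n + p)%N, (F _ c d), (F _ g h); split.
    by move=> i; rewrite /F; case: split.
  rewrite big_split_ord /=; congr (_ + _); apply: eq_bigr => i _.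
    by rewrite /F (unsplitK (inl _ i)).
  by rewrite /F (unsplitK (inr _ i)).
- move=> a _ [n [c [g [Xg ->]]]]; exists n, (fun i => a * c i), g; split=> //.
  by rewrite scaler_sumr; apply: eq_bigr => i _; rewrite scalerA.
Qed.
Hint Resolve span_submod : core.

Lemma span_mono X Y : X `<=` Y -> span X `<=` span Y.
Proof. by move=> XY; apply: span_min => // x /XY; apply: sub_span. Qed.

Lemma span_rangeP (J : finType) (g : J -> V) x :
  span (range g) x <-> exists c : J -> R, x = \sum_i c i *: g i.
Proof.
split=> [|[c ->]]; last first.
  by apply: submod_sum => // i _; apply: submodZ => //; apply: sub_span; exists i.
have: submod [set x | exists c : J -> R, x = \sum_i c i *: g i].
  split.
  - by exists (fun=> 0); rewrite big1 // => i _; rewrite scale0r.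
  - move=> _ _ [c ->] [d ->]; exists (fun i => c i + d i).
    by rewrite -big_split; apply: eq_bigr => i _; rewrite scalerDl.
  - move=> a _ [c ->]; exists (fun i => a * c i).
    by rewrite scaler_sumr; apply: eq_bigr => i _; rewrite scalerA.
move/span_min; apply=> _ [i _ <-]; exists (fun j => (j == i)%:R).
rewrite (bigD1 i) //= eqxx scale1r big1 ?addr0 // => j /negbTE ->.
by rewrite scale0r.
Qed.

Lemma smul_submod I U : submod (smul I U). Proof. exact: span_submod. Qed.
Hint Resolve smul_submod : core.

Lemma smulI I U a x : I a -> U x -> smul I U (a *: x).
Proof. by move=> Ia Ux; apply: sub_span; exists a, x. Qed.

Lemma smul_min I U W : submod W ->
  (forall a x, I a -> U x -> W (a *: x)) -> smul I U `<=` W.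
Proof. by move=> sW h; apply: span_min => // _ [a [x [? ? ->]]]; apply: h. Qed.

Lemma smul_mono I U W : U `<=` W -> smul I U `<=` smul I W.
Proof. by move=> UW; apply: smul_min => // a x Ia /UW; apply: smulI. Qed.

Lemma smul_rangeP (J : finType) I (g : J -> V) x : ideal I ->
  smul I (span (range g)) x ->
  exists c : J -> R, (forall i, I (c i)) /\ x = \sum_i c i *: g i.
Proof.
move=> [I0 ID IM].
suff: submod [set x | exists c : J -> R, (forall i, I (c i)) /\ x = \sum_i c i *: g i].
  move/smul_min; apply=> a y Ia /span_rangeP[c ->].
  exists (fun i => c i * a); split=> [i|]; first exact: IM.
  by rewrite scaler_sumr; apply: eq_bigr => i _; rewrite scalerA mulrC.
split.
- by exists (fun=> 0); split=> //; rewrite big1 // => i _; rewrite scale0r.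
- move=> _ _ [c [Ic ->]] [d [Id ->]]; exists (fun i => c i + d i).
  split=> [i|]; first exact: ID.
  by rewrite -big_split; apply: eq_bigr => i _; rewrite scalerDl.
- move=> a _ [c [Ic ->]]; exists (fun i => a * c i).
  split=> [i|]; first exact: IM.
  by rewrite scaler_sumr; apply: eq_bigr => i _; rewrite scalerA.
Qed.

Lemma fg_range (J : finType) (g : J -> V) : finitely_generated (span (range g)).
Proof.
exists #|J|, (fun i => g (enum_val i)); congr (span _); apply/seteqP.
split=> _ [i _ <-]; last by exists (enum_val i).
by exists (enum_rank i) => //=; rewrite enum_rankK.
Qed.

Lemma span_range_sub (J : finType) (g : J -> V) U :
  submod U -> (forall i, U (g i)) -> span (range g) `<=` U.
Proof. by move=> sU Ug; apply: span_min => // _ [i _ <-]. Qed.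

Lemma mem_span_range (J : Type) (g : J -> V) i : span (range g) (g i).
Proof. by apply: sub_span; exists i. Qed.

End Submodules.

#[export] Hint Resolve span_submod smul_submod submodT : core.

Lemma linear_smul (R : comNzRingType) (V W : lmodType R) (f : {linear V -> W})
    (I : set R) (U : set V) (U' : set W) :
  (forall x, U x -> U' (f x)) -> forall x, smul I U x -> smul I U' (f x).
Proof.
move=> fU x; suff: smul I U `<=` [set x | smul I U' (f x)] by apply.
apply: smul_min; last by move=> a y Ia Uy /=; rewrite linearZ; apply: smulI => //; apply: fU.
split=> /= [|y z hy hz|a y hy]; first by rewrite linear0; apply: submod0.
- by rewrite linearD; apply: submodD.
- by rewrite linearZ; apply: submodZ.
Qed.

Section Noetherian.
Variable R : comNzRingType.
Hypothesis noeR : noetherian R.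

(** Otherwise choice yields a strictly increasing sequence. Its union is a finitely generated ideal,
    so the generators, and with them the union, already lie in one term. *)
Lemma noetherian_max (P : set (set R)) : (exists I, ideal I /\ P I) ->
  exists I, [/\ ideal I, P I & forall I', ideal I' -> P I' -> I `<=` I' -> I' `<=` I].
Proof.
move=> [I0 PI0]; apply: contrapT => nex.
pose T := {I : set R | ideal I /\ P I}.
have step (t : T) : exists t' : T, proj1_sig t `<=` proj1_sig t' /\
    ~ (proj1_sig t' `<=` proj1_sig t).
  case: t => I [iI PI] /=; apply: contrapT => h; apply: nex; exists I; split=> //.
  move=> I' iI' PI' II'; apply: contrapT => nI'; apply: h.
  by exists (exist _ I' (conj iI' PI')).
have [f fP] := choice step.
pose t n := iter n f (exist _ I0 PI0 : T); pose s n := proj1_sig (t n).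
have smono n k : s n `<=` s (n + k)%N.
  by elim: k => [|k IH]; rewrite ?addn0 ?addnS //; apply: subset_trans IH (fP _).1.
have smax n k x : (n <= k)%N -> s n x -> s k x.
  by move=> nk; rewrite -(subnKC nk); apply: smono.
have si n : ideal (s n) := (proj2_sig (t n)).1.
have iU : ideal [set x | exists n, s n x].
  split; first by exists 0%N; case: (si 0%N).
  - move=> x y [n sx] [k sy]; exists (maxn n k); case: (si (maxn n k)) => _ + _.
    by apply; [apply: smax sx | apply: smax sy]; rewrite ?leq_maxl ?leq_maxr.
  - by move=> a x [n sx]; exists n; case: (si n) => _ _; apply.
have [n [g eU]] := noeR iU.
have /choice[h hP] i : exists k, s k (g i).
  have: [set x | exists n, s n x] (g i) by rewrite eU; apply: mem_span_range.
  by [].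
pose N := (\max_i h i)%N.
have UN : [set x | exists n, s n x] `<=` s N.
  rewrite eU; apply: (@span_min R R^o _ _ (si N)).
  by move=> _ [i _ <-]; apply: smax (hP i); apply: (leq_bigmax (F := h)).
by apply: (fP (t N)).2 => x sx; apply: UN; exists N.+1.
Qed.

(** Induction on n through the ideal [I] of coefficients of [g ord0] in elements of U: lifts [u] of
    its generators and generators [v] of the part of U in the span of [g'] together generate U. *)
Lemma noetherian_submod (V : lmodType R) n (g : 'I_n -> V) (U : set V) :
  submod U -> U `<=` span (range g) -> finitely_generated U.
Proof.
elim: n g U => [|n IH] g U sU Ug.
  exists 0%N, g; apply/seteqP; split=> // x /span_rangeP[c ->].
  by rewrite big_ord0; apply: submod0.
pose g' i := g (lift ord0 i).
pose I := [set a | exists2 x, U x & span (range g') (x - a *: g ord0)].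
have iI : ideal I.
  split; first by exists 0; rewrite ?scale0r ?subr0; apply: submod0.
  - move=> a b [x Ux hx] [y Uy hy]; exists (x + y); first exact: submodD.
    by rewrite scalerDl opprD addrACA; apply: submodD.
  - move=> a b [x Ux hx]; exists (a *: x); first exact: submodZ.
    by rewrite -scalerA -scalerBr; apply: submodZ.
have [k [a eI]] := noeR iI.
have /choice[u uP] i : exists x, U x /\ span (range g') (x - a i *: g ord0).
  have : I (a i) by rewrite eI; apply: mem_span_range.
  by case=> x Ux hx; exists x.
have [k' [v eU']] := IH g' (U `&` span (range g')) (submodI sU (@span_submod _ _ _)) (@subIsetr _ _ _).
pose w (i : 'I_k + 'I_k') := match i with inl j => u j | inr j => v j end.
have Uv j : U (v j).
  by have [] : (U `&` span (range g')) (v j) by rewrite eU'; apply: mem_span_range.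
suff -> : U = span (range w) by apply: fg_range.
apply/seteqP; split; last first.
  apply: span_range_sub => // -[j|j] //=; exact: (uP j).1.
move=> x Ux; have /span_rangeP[c ex] := Ug _ Ux.
have Ic : I (c ord0).
  exists x => //; apply/span_rangeP; exists (fun i => c (lift ord0 i)).
  by rewrite ex big_ord_recl addrC addKr.
have [d ed] : exists d : 'I_k -> R, c ord0 = \sum_i d i * a i.
  by move: Ic; rewrite eI => /span_rangeP[d ->]; exists d.
pose y := \sum_i d i *: u i.
have Uy : U y by apply: submod_sum => // i _; apply: submodZ => //; exact: (uP i).1.
have hxy : span (range w) (x - y).
  have : (U `&` span (range g')) (x - y).
    split; first exact: submodB.
    rewrite ex big_ord_recl ed scaler_suml addrAC /y -sumrB.
    apply: submodD => //; last by apply/span_rangeP; eexists.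
    apply: submod_sum => // i _; rewrite -scalerA -scalerBr.
    by apply: submodZ => //; rewrite -opprB; apply: submodN => //; exact: (uP i).2.
  rewrite eU'; apply: span_range_sub => // j; exact: (@mem_span_range _ _ _ w (inr j)).
rewrite -(subrK y x); apply: submodD => //; apply: submod_sum => // i _.
apply: submodZ => //; exact: (@mem_span_range _ _ _ w (inl i)).
Qed.

End Noetherian.

(** Nakayama's lemma at the prime p without localizing: W is saturated with respect to the
    complement of p, so it stands for a submodule of the localization. It serves local rings as well
    as the primes in the height theorem. *)
Lemma nakayama_prime (R : comNzRingType) (V : lmodType R) (p : set R) n
    (g : 'I_n -> V) (W : set V) : prime_ideal p -> submod W ->
  (forall t x, ~ p t -> W (t *: x) -> W x) ->
  (forall i, exists t, exists a : 'I_n -> R, [/\ ~ p t, forall j, p (a j) &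
     W (t *: g i - \sum_j a j *: g j)]) -> forall i, W (g i).
Proof.
move=> [ip p1 pP] sW satW; elim: n g => [|n IH] g gP; first by case.
have sp : @submod R R^o p := ip.
have [t0 [a0 [pt0 pa0 Wa0]]] := gP ord0.
(* [u] is a unit at p. Up to [u], the first relation expresses [g ord0] through the other
   generators, and substituting it into the remaining relations keeps their shape. *)
pose g' i := g (lift ord0 i); pose u := t0 - a0 ord0.
have pu : ~ p u.
  by move=> pu; apply: pt0; rewrite -(subrK (a0 ord0) t0); apply: (submodD sp).
have Wg0 : W (u *: g ord0 - \sum_j a0 (lift ord0 j) *: g' j).
  by move: Wa0; rewrite big_ord_recl scalerBl opprD addrA.
have Wg' : forall i, W (g' i).
  apply: IH => i; have [t [a [pt pa Wa]]] := gP (lift ord0 i).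
  exists (u * t), (fun j => u * a (lift ord0 j) + a ord0 * a0 (lift ord0 j)); split.
  - by move=> /pP[].
  - by move=> j; apply: (submodD sp); apply: (submodZ _ sp).
  move: Wa; rewrite big_ord_recl -/(g' i) => Wa.
  have -> : \sum_j (u * a (lift ord0 j) + a ord0 * a0 (lift ord0 j)) *: g' j =
    u *: (\sum_j a (lift ord0 j) *: g' j) + a ord0 *: \sum_j a0 (lift ord0 j) *: g' j.
    rewrite !scaler_sumr -big_split; apply: eq_bigr => j _.
    by rewrite scalerDl !scalerA.
  have := submodD sW (submodZ u sW Wa) (submodZ (a ord0) sW Wg0).
  by congr W; module.
move=> i; case: (unliftP ord0 i) => [j ->|->]; first exact: Wg'.
apply: (satW u) => //; apply/(submod_eqm sW Wg0); apply: submod_sum => // j _.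
exact: submodZ.
Qed.

Section Local.
Variables (R : comNzRingType) (m : set R).

(** This form of locality is easy to check for quotients, where only the image of the maximal ideal
    is at hand. *)
Definition local_units : Prop :=
  [/\ ideal m, ~ m 1 & forall x, ~ m x -> exists y, y * x = 1].

(** If x had no inverse, an ideal maximal among the proper ones containing x, which Noetherianity
    supplies, would be a maximal ideal, hence m. *)
Lemma noetherian_local_units : noetherian_local m -> local_units.
Proof.
move=> [noeR [[im m1 _] uniq_m]]; split=> // x nmx; apply: contrapT => nux.
have iRx : ideal [set y | exists z, y = z * x].
  split; first by exists 0; rewrite mul0r.
  - by move=> _ _ [z ->] [t ->]; exists (z + t); rewrite mulrDl.
  - by move=> a _ [z ->]; exists (a * z); rewrite mulrA.
have [|m' [im' [m'1 m'x] m'max]] :=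
    @noetherian_max _ noeR [set I | ~ I 1 /\ I x].
  exists [set y | exists z, y = z * x]; split=> //; split.
    by case=> z e1; apply: nux; exists z.
  by exists 1; rewrite mul1r.
apply: nmx; suff <- : m' = m by [].
apply: uniq_m; split=> // I iI I1 m'I; apply/seteqP; split=> //.
by apply: m'max => //; split=> //; apply: m'I.
Qed.

Hypothesis mL : local_units.
Let im : ideal m. Proof. by case: mL. Qed.
Let sm : @submod R R^o m := im.

Lemma local_prime a b : m (a * b) -> m a \/ m b.
Proof.
move=> mab; have [ma|nma] := pselect (m a); [by left|right].
by case: mL => _ _ /(_ a nma)[y ya]; rewrite -(mul1r b) -ya -mulrA; case: im => _ _; apply.
Qed.

Section Nakayama.
Variable V : lmodType R.

Lemma nakayama_range n (g : 'I_n -> V) (W : set V) : submod W ->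
  (forall i, exists a : 'I_n -> R, (forall j, m (a j)) /\
     W (g i - \sum_j a j *: g j)) -> forall i, W (g i).
Proof.
case: mL => _ m1 mU sW gP; apply: (@nakayama_prime _ _ m) => //.
- by split=> // a b; apply: local_prime.
- by move=> t x /mU[y yt] Wtx; rewrite -[x]scale1r -yt -scalerA; apply: submodZ.
- by move=> i; have [a [ma Wa]] := gP i; exists 1, a; rewrite scale1r.
Qed.

Lemma nakayama (U W : set V) : finitely_generated U -> submod W ->
  (forall x, U x -> exists2 y, W y & smul m U (x - y)) -> U `<=` W.
Proof.
move=> [n [g ->]] sW gP; apply: span_range_sub => //; apply: nakayama_range => // i.
have [y Wy hy] := gP _ (mem_span_range g i).
have [a [ma ea]] := smul_rangeP im hy.
by exists a; split=> //; rewrite -ea subKr.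
Qed.

Lemma nakayama0 (U : set V) : finitely_generated U -> U `<=` smul m U ->
  forall x, U x -> x = 0.
Proof.
move=> fU hU; apply: (@nakayama U [set 0]) => //.
  by split=> // [_ _ -> ->|a _ ->] /=; rewrite ?addr0 ?scaler0.
by move=> x /hU hx; exists 0; rewrite ?subr0.
Qed.

(** When m U lies in W, [u] represents a basis of U / W over the residue field. Coefficients stay in
    R, so no quotient space is formed. *)
Definition mod_basis (J : finType) (u : J -> V) (U W : set V) : Prop :=
  [/\ forall i, U (u i),
      forall x, U x -> exists c : J -> R, W (x - \sum_i c i *: u i)
    & forall c : J -> R, W (\sum_i c i *: u i) -> forall i, m (c i)].

Definition spans_mod n (u : 'I_n -> V) (U W : set V) : Prop :=
  (forall i, U (u i)) /\
  forall x, U x -> exists c : 'I_n -> R, W (x - \sum_i c i *: u i).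

(** A coefficient outside m in a relation modulo W would be invertible, and its generator could be
    dropped, against minimality. *)
Lemma minimal_mod_basis n (u : 'I_n -> V) (U W : set V) :
  submod W -> spans_mod u U W ->
  (forall p (v : 'I_p -> V), spans_mod v U W -> (n <= p)%N) ->
  mod_basis u U W.
Proof.
move=> sW [Uu uP] minu; split=> // c Wc i; apply: contrapT => nmi.
case: mL => _ _ /(_ _ nmi)[y yc].
case: n u Uu uP minu c Wc i nmi yc => [|n] u Uu uP minu c Wc i nmi yc; first by case: i {nmi yc}.
suff: (n.+1 <= n)%N by rewrite ltnn.
apply: (minu _ (fun j => u (lift i j))); split=> // x /uP[d Wd].
exists (fun j => d (lift i j) - d i * y * c (lift i j)).
have := submodD sW Wd (submodZ (d i * y) sW Wc).
rewrite !(bigD1_ord i) //= scalerDr [_ *: (c i *: _)]scalerA -mulrA yc mulr1.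
set S := \sum_(_ < n) _; set S' := \sum_(_ < n) _; set S'' := \sum_(_ < n) _.
have -> : S'' = S - (d i * y) *: S'.
  rewrite scaler_sumr -sumrB; apply: eq_bigr => j _.
  by rewrite scalerBl scalerA.
by congr W; module.
Qed.

Lemma exists_mod_basis n (u : 'I_n -> V) (U W : set V) :
  submod W -> spans_mod u U W ->
  exists (r : nat) (v : 'I_r -> V), mod_basis v U W.
Proof.
move=> sW uP.
pose P k := `[< exists v : 'I_k -> V, spans_mod v U W >].
have exP : exists k, P k by exists n; apply/asboolP; exists u.
case: (ex_minnP exP) => r /asboolP[v vP] rmin; exists r, v.
apply: minimal_mod_basis => // p w wP; apply: rmin; apply/asboolP; by exists w.
Qed.

End Nakayama.
End Local.

(** * Koszul complexes *)

Section Koszul.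
Variable R : comNzRingType.

Definition tl n T (x : 'I_n.+1 -> T) (i : 'I_n) : T := x (lift ord0 i).

(* [kos V n] is the exterior algebra on e_0, ..., e_(n-1) with coefficients in
   [V]: the pair (u, v) stands for u + e_0 v, with u and v not involving e_0. *)
Fixpoint kos (V : lmodType R) n : lmodType R :=
  if n is n'.+1 then (kos V n' * kos V n')%type : lmodType R else V.

Section Module.
Variable V : lmodType R.
Local Notation kos := (kos V).

(** Contraction sending e_i to x_i; the sign comes from moving past e_0. In the same coordinates
    [kwedge c] is left multiplication by sum_i c_i e_i. *)
Fixpoint kd n : ('I_n -> R) -> kos n -> kos n :=
  match n with
  | 0 => fun _ _ => 0
  | n'.+1 => fun x w => (kd (tl x) w.1 + x ord0 *: w.2, - kd (tl x) w.2)
  end.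

Fixpoint kwedge n : ('I_n -> R) -> kos n -> kos n :=
  match n with
  | 0 => fun _ _ => 0
  | n'.+1 => fun c w => (kwedge (tl c) w.1, c ord0 *: w.1 - kwedge (tl c) w.2)
  end.

Fixpoint kone n : V -> kos n :=
  match n with 0 => id | n'.+1 => fun v => (kone n' v, 0) end.

Fixpoint ktop n : V -> kos n :=
  match n with 0 => id | n'.+1 => fun v => (0, ktop n' v) end.

Fixpoint kbot n : kos n -> V :=
  match n with 0 => id | n'.+1 => fun w => kbot w.1 end.

Fixpoint klast n : kos n -> V :=
  match n with 0 => id | n'.+1 => fun w => klast w.2 end.

Fixpoint kin (U : set V) n : set (kos n) :=
  match n with 0 => U | n'.+1 => fun w => @kin U n' w.1 /\ @kin U n' w.2 end.

(* elements without components of degree < i *)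
Fixpoint kge n (i : nat) : set (kos n) :=
  match n with
  | 0 => fun w => (0 < i)%N -> w = 0
  | n'.+1 => fun w => kge (n := n') i w.1 /\ kge (n := n') i.-1 w.2
  end.

Fact kd_linear n x : linear (@kd n x).
Proof.
elim: n x => [x a u v|n IH x a [u v] [u' v']] /=; first by rewrite scaler0 addr0.
by rewrite !IH; congr (_, _) => /=; module.
Qed.
HB.instance Definition _ n x :=
  GRing.isLinear.Build R (kos n) (kos n) *:%R (@kd n x) (@kd_linear n x).

Fact kwedge_linear n c : linear (@kwedge n c).
Proof.
elim: n c => [c a u v|n IH c a [u v] [u' v']] /=; first by rewrite scaler0 addr0.
by rewrite !IH; congr (_, _) => /=; module.
Qed.
HB.instance Definition _ n c :=
  GRing.isLinear.Build R (kos n) (kos n) *:%R (@kwedge n c) (@kwedge_linear n c).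

Fact kone_linear n : linear (kone n).
Proof. by elim: n => [|n IH] a u v //=; rewrite IH; congr (_, _); rewrite /= scaler0 addr0. Qed.
HB.instance Definition _ n :=
  GRing.isLinear.Build R V (kos n) *:%R (kone n) (@kone_linear n).

Fact ktop_linear n : linear (ktop n).
Proof. by elim: n => [|n IH] a u v //=; rewrite IH; congr (_, _); rewrite /= scaler0 addr0. Qed.
HB.instance Definition _ n :=
  GRing.isLinear.Build R V (kos n) *:%R (ktop n) (@ktop_linear n).

Fact kbot_linear n : linear (@kbot n).
Proof. by elim: n => [|n IH] a u v //=; rewrite IH. Qed.
HB.instance Definition _ n :=
  GRing.isLinear.Build R (kos n) V *:%R (@kbot n) (@kbot_linear n).

Fact klast_linear n : linear (@klast n).
Proof. by elim: n => [|n IH] a u v //=; rewrite IH. Qed.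
HB.instance Definition _ n :=
  GRing.isLinear.Build R (kos n) V *:%R (@klast n) (@klast_linear n).

Lemma kdD n x : {morph @kd n x : u v / u + v}. Proof. exact: linearD. Qed.
Lemma kdN n x : {morph @kd n x : u / - u}. Proof. exact: linearN. Qed.
Lemma kdZ n x a u : @kd n x (a *: u) = a *: kd x u. Proof. exact: linearZ. Qed.
Lemma kwedgeD n c : {morph @kwedge n c : u v / u + v}. Proof. exact: linearD. Qed.
Lemma kwedgeN n c : {morph @kwedge n c : u / - u}. Proof. exact: linearN. Qed.
Lemma kwedgeZ n c a u : @kwedge n c (a *: u) = a *: kwedge c u.
Proof. exact: linearZ. Qed.

Lemma koneZ n a v : kone n (a *: v) = a *: kone n v.
Proof. exact: linearZ. Qed.
Lemma ktopZ n a v : ktop n (a *: v) = a *: ktop n v.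
Proof. exact: linearZ. Qed.

Definition klinE := (kdD, kdN, kdZ, kwedgeD, kwedgeN, kwedgeZ).

Lemma kd_kd n (x : 'I_n -> R) w : kd x (kd x w) = 0.
Proof.
elim: n x w => [//|n IH] x [u v] /=.
by rewrite !klinE !IH; congr (_, _) => /=; module.
Qed.

(** The homotopy formula: exterior multiplication by c makes multiplication by sum_i c_i x_i
    null-homotopic. The Koszul arguments below rest on it. *)
Lemma kd_kwedge n (x c : 'I_n -> R) w :
  kd x (kwedge c w) = (\sum_i c i * x i) *: w - kwedge c (kd x w).
Proof.
elim: n x c w => [|n IH] x c w /=; first by rewrite big_ord0 scale0r subr0.
case: w => u v; rewrite big_ord_recl; have := IH (tl x) (tl c).
rewrite [X in X *: _]/= -/(tl _ _); set s := \sum_(_ < n) _ => {}IH.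
congr (_, _) => /=.
  by rewrite !klinE IH; module.
by rewrite !klinE IH; module.
Qed.

Lemma kd_kone n (x : 'I_n -> R) v : kd x (kone n v) = 0.
Proof.
elim: n x => //= n IH x; rewrite IH; congr (_, _) => /=; last by rewrite linear0 oppr0.
by rewrite scaler0 addr0.
Qed.

Lemma kin_submod U n : submod U -> submod (@kin U n).
Proof.
move=> sU; elim: n => //= n [IH0 IHD IHZ]; split=> //=.
- by move=> x y [? ?] [? ?]; split; apply: IHD.
- by move=> a x [? ?]; split; apply: IHZ.
Qed.

Lemma kin_kd U n (x : 'I_n -> R) w : submod U -> kin U w -> kin U (kd x w).
Proof.
move=> sU; elim: n x w => [|n IH] x w /=; first by move=> _; apply: submod0.
move=> [? ?]; have sk := kin_submod n sU; split; last by apply: submodN => //; apply: IH.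
by apply: submodD => //; [apply: IH | apply: submodZ].
Qed.

Lemma kin_kwedge U n (c : 'I_n -> R) w : submod U -> kin U w -> kin U (kwedge c w).
Proof.
move=> sU; elim: n c w => [|n IH] c w /=; first by move=> _; apply: submod0.
move=> [? ?]; have sk := kin_submod n sU; split; first exact: IH.
by apply: submodB => //; [apply: submodZ | apply: IH].
Qed.

Lemma kin_mono (U W : set V) n : U `<=` W -> kin U (n := n) `<=` kin W (n := n).
Proof. by move=> UW; elim: n => //= n IH [u v] [/= ? ?]; split; apply: IH. Qed.

Lemma kin_klast U n (w : kos n) : kin U w -> U (klast w).
Proof. by elim: n w => //= n IH w [_ /IH]. Qed.

Lemma kin_kbot U n (w : kos n) : kin U w -> U (kbot w).
Proof. by elim: n w => //= n IH w [/IH]. Qed.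

Lemma kin0 n (w : kos n) : kin [set 0] w -> w = 0.
Proof. by elim: n w => //= n IH [u v] [/= /IH -> /IH ->]. Qed.

Lemma kge_submod n i : submod (@kge n i).
Proof.
elim: n i => [|n IH] i /=.
  split=> // [x y x0 y0 i0|a x x0 i0]; first by rewrite x0 // y0 // addr0.
  by rewrite x0 // scaler0.
split=> /=; first by split; apply: submod0.
- by move=> x y [? ?] [? ?]; split; apply: submodD.
- by move=> a x [? ?]; split; apply: submodZ.
Qed.

Lemma kge0 n (w : kos n) : kge 0 w.
Proof. by elim: n w => //= n IH w; split; apply: IH. Qed.

Lemma kge_leq n i j (w : kos n) : (i <= j)%N -> kge j w -> kge i w.
Proof.
elim: n i j w => [|n IH] i j w ij /=; first by move=> w0 i0; apply: w0; apply: leq_trans ij.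
by move=> [w1 w2]; split; [apply: IH w1 | apply: IH w2; rewrite -!subn1 leq_sub2r].
Qed.

Lemma kge_gt n i (w : kos n) : (n < i)%N -> kge i w -> w = 0.
Proof.
elim: n i w => [|n IH] i w ni /=; first by apply.
case: w => u v [/= gu gv]; congr (_, _); first exact: IH (ltnW ni) gu.
by apply: IH gv; case: i ni {gu}.
Qed.

Lemma kge_kd n (x : 'I_n -> R) i w : kge i w -> kge i.-1 (kd x w).
Proof.
elim: n i x w => [|n IH] i x w //= [w1 w2].
have sk j := kge_submod n j; split.
  by apply: submodD => //; [apply: IH | apply: submodZ].
by apply: submodN => //; apply: IH.
Qed.

Lemma kge_kwedge n (c : 'I_n -> R) i w : kge i w -> kge i.+1 (kwedge c w).
Proof.
elim: n i c w => [|n IH] i c w //= [w1 w2].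
have sk j := kge_submod n j; split; first exact: IH.
apply: submodB => //; first exact: submodZ.
by apply: kge_leq (IH _ _ _ w2); apply: leqSpred.
Qed.

Lemma kge_kbot n (w : kos n) : kge 1 (w - kone n (kbot w)).
Proof.
elim: n w => [|n IH] w /=; first by rewrite subrr.
split; first exact: IH.
exact: kge0.
Qed.

Lemma kge_ktop n v : kge n (ktop n v).
Proof. by elim: n => //= n IH; split=> //; apply: submod0; apply: kge_submod. Qed.

Lemma kin_ktop U n v : submod U -> U v -> kin U (ktop n v).
Proof.
move=> sU Uv; elim: n => //= n IH; split=> //.
by apply: submod0; apply: kin_submod.
Qed.

Lemma klast_ktop n v : klast (ktop n v) = v.
Proof. by elim: n. Qed.

Lemma kbot_kone n v : kbot (kone n v) = v.
Proof. by elim: n. Qed.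

Lemma kin_kd_ktop U n (x : 'I_n -> R) v : submod U ->
  (forall i, U (x i *: v)) -> kin U (kd x (ktop n v)).
Proof.
move=> sU; elim: n x => [|n IH] x Uv /=; first exact: submod0.
have sk := kin_submod n sU; split; last by apply: submodN => //; apply: IH => i; apply: Uv.
rewrite linear0 add0r -linearZ; elim: n {IH sk} x Uv => [|n IH] x Uv /=; first exact: Uv.
split; first by apply: submod0; apply: kin_submod.
by apply: (IH (fun i => x ord0)) => _; apply: Uv.
Qed.

Lemma ksum_fst n (J : finType) (F : J -> kos n.+1) :
  (\sum_j F j).1 = \sum_j (F j).1.
Proof. by apply: (big_morph (fun w : kos n.+1 => w.1)). Qed.

Lemma ksum_snd n (J : finType) (F : J -> kos n.+1) :
  (\sum_j F j).2 = \sum_j (F j).2.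
Proof. by apply: (big_morph (fun w : kos n.+1 => w.2)). Qed.

(** Division by the [s j] modulo U is done coefficient by coefficient, so it respects the lower
    bound on degrees. *)
Lemma kin_split (J : finType) (s : J -> R) (U W : set V) n i (w : kos n) : submod U ->
  (forall v, W v -> exists f : J -> V, U (v - \sum_j s j *: f j)) ->
  kge i w -> kin W w -> exists f : J -> kos n,
    (forall j, kge i (f j)) /\ kin U (w - \sum_j s j *: f j).
Proof.
move=> sU WU; elim: n i w => [|n IH] i w /=.
  case: i => [|i] w0 Ww.
    by have [f Uf] := WU _ Ww; exists f; split.
  exists (fun=> 0); split=> [j _ //|]; rewrite w0 // big1 ?subr0; first exact: submod0.
  by move=> j _; rewrite scaler0.
case: w => u v [/= gu gv] [/= Wu Wv].
have [f [gf Uf]] := IH _ _ gu Wu; have [h [gh Uh]] := IH _ _ gv Wv.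
exists (fun j => (f j, h j)); split; first by move=> j; split; [exact: gf | exact: gh].
pose F j : kos n.+1 := s j *: ((f j, h j) : kos n.+1).
change (kin U (u - (\sum_j F j).1) /\ kin U (v - (\sum_j F j).2)).
by rewrite ksum_fst ksum_snd.
Qed.

Lemma kin_inj (J : finType) (s : J -> R) (U W : set V) n (f : J -> kos n) :
  (forall f : J -> V, U (\sum_j s j *: f j) -> forall j, W (f j)) ->
  kin U (\sum_j s j *: f j) -> forall j, kin W (f j).
Proof.
move=> inj; elim: n f => [|n IH] f; first exact: inj.
pose F j : kos n.+1 := s j *: f j.
change (kin U (\sum_j F j).1 /\ kin U (\sum_j F j).2 -> forall j, kin W (f j)).
rewrite ksum_fst ksum_snd => -[Uf Uh] j.
by split; [apply: (IH (fun j => (f j).1)) | apply: (IH (fun j => (f j).2))].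
Qed.

Lemma kbot_kd U n (x : 'I_n -> R) w : submod U ->
  (forall i v, U (x i *: v)) -> U (kbot (kd x w)).
Proof.
move=> sU; elim: n x w => [|n IH] x w xU /=; first exact: submod0.
rewrite linearD linearZ /=; apply: submodD => //.
by apply: IH => i; apply: xU.
Qed.

Definition kprod n k (r : 'I_k -> 'I_n -> R) (w : kos n) : kos n :=
  foldr (fun i => kwedge (r i)) w (enum 'I_k).

Lemma kprodS n k (r : 'I_k.+1 -> 'I_n -> R) w :
  kprod r w = kwedge (r ord0) (kprod (tl r) w).
Proof. by rewrite /kprod enum_ordSl /= foldr_map. Qed.

Lemma kprod0 n (r : 'I_0 -> 'I_n -> R) w : kprod r w = w.
Proof. by rewrite /kprod (size0nil (size_enum_ord 0)). Qed.

Lemma kprod_fst n k (r : 'I_k -> 'I_n.+1 -> R) (w : kos n.+1) :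
  (kprod r w).1 = kprod (fun i => tl (r i)) w.1.
Proof.
by rewrite /kprod; elim: (enum 'I_k) => //= i s ->.
Qed.

(** The e_0-part of a product of rows already has the shape of a Laplace expansion along the first
    column. *)
Lemma kprod_snd n k (r : 'I_k.+1 -> 'I_n.+1 -> R) v :
  (kprod r (kone n.+1 v)).2 = \sum_(i < k.+1) ((-1) ^+ i * r i ord0) *:
     kprod (fun j => tl (r (lift i j))) (kone n v).
Proof.
elim: k r => [|k IH] r.
  by rewrite kprodS /= !kprod0 linear0 subr0 big_ord1 expr0 mul1r kprod0.
rewrite kprodS /= IH [RHS]big_ord_recl kprod_fst expr0 mul1r. congr (_ + _).
rewrite linear_sum -sumrN; apply: eq_bigr => i _; rewrite linearZ /= -scaleNr.
congr (_ *: _); first by rewrite /bump exprS /tl; ring.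
rewrite [RHS]kprodS; congr (kwedge _ _); first by congr (tl (r _)); apply: val_inj.
congr (foldr _ _ _); apply/funext => j; congr (kwedge _); apply/funext => l.
by rewrite /tl; congr (r _ _); apply: val_inj; rewrite /= /bump /= !add1n ltnS addnS.
Qed.

Lemma kge_kprod n k (r : 'I_k -> 'I_n -> R) w : kge k (kprod r w).
Proof.
elim: k r => [|k IH] r; first exact: kge0.
by rewrite kprodS; apply: kge_kwedge.
Qed.

Lemma kprod_det n (a : 'M[R]_n) v :
  kprod (fun i => a i) (kone n v) = ktop n (\det a *: v).
Proof.
elim: n a => [|n IH] a; first by rewrite kprod0 det_mx00 scale1r.
rewrite [LHS]surjective_pairing kprod_snd kprod_fst /=; congr (_, _).
  (* The part without e_0 is a product of n + 1 vectors in n variables, so it vanishes for degree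
     reasons. *)
  by apply: (@kge_gt n n.+1) => //; apply: kge_kprod.
rewrite (expand_det_col a ord0) scaler_suml linear_sum; apply: eq_bigr => i _.
rewrite /cofactor addn0 mulrA [a i ord0 * _]mulrC -[in RHS]scalerA.
rewrite [RHS]ktopZ -IH; congr (_ *: _); congr (foldr _ _ _); apply/funext => j; congr (kwedge _).
by apply/funext => l; rewrite /tl !mxE.
Qed.

End Module.
End Koszul.

(** * Koszul homology of [y] on R / I_j, where I_j is generated by the first j terms of a regular
    sequence *)

Section KoszulRegular.
Variables (R : comNzRingType) (d p : nat) (y : 'I_d -> R) (s : nat -> R).
Variables (c : nat -> 'I_d -> R) (I : nat -> set R).
Local Notation E := (kos R^o d).
Local Notation kinR J := (@kin R R^o J d).
Hypothesis I_submod : forall j, @submod R R^o (I j).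
Hypothesis I0 : I 0%N = [set 0].
Hypothesis IS : forall j v, (j < p)%N ->
  I j.+1 v <-> exists a, I j (v - s j * a).
Hypothesis sE : forall j, (j < p)%N -> s j = \sum_i c j i * y i.
Hypothesis s_reg : forall j v, (j < p)%N -> I j (s j * v) -> I j v.

Let sk j : submod (kinR (I j)) := kin_submod d (I_submod j).
Let sg i : submod (@kge _ R^o d i) := kge_submod R^o d i.

Lemma kin_split1 j i (w : E) : (j < p)%N -> kge i w -> kinR (I j.+1) w ->
  exists2 v : E, kge i v & kinR (I j) (w - s j *: v).
Proof.
move=> jp gw Iw.
have IU (v : R^o) : I j.+1 v -> exists f : unit -> R^o, I j (v - \sum_u s j *: f u).
  by move=> /(IS _ jp)[a Ia]; exists (fun=> a); rewrite (big_pred1 tt) // => -[].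
have [f [gf If]] := kin_split (I_submod j) IU gw Iw.
by exists (f tt) => //; move: If; rewrite (big_pred1 tt) // => -[].
Qed.

Lemma kinS j (w : E) : (j < p)%N -> kinR (I j) w -> kinR (I j.+1) w.
Proof.
move=> jp; apply: kin_mono => v Iv; apply/(IS _ jp).
by exists 0; rewrite mulr0 subr0.
Qed.

Lemma kinSs j (w : E) : (j < p)%N -> kinR (I j.+1) (s j *: w).
Proof.
move=> jp; have: forall v : R^o, I j.+1 (s j *: v).
  move=> v; apply/(IS _ jp); exists v; rewrite subrr; exact: submod0 (I_submod j).
by elim: d w => [|n IH] w h //=; split; apply: IH.
Qed.

Lemma kin_reg j (w : E) : (j < p)%N -> kinR (I j) (s j *: w) -> kinR (I j) w.
Proof.
move=> jp; elim: d w => [|n IH] w /=; first exact: s_reg.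
by move=> [? ?]; split; apply: IH.
Qed.

(* Multiplication by s_j is null-homotopic on the Koszul complex of [y], so its
   homology on R / I_(j+1) surjects onto that on R / I_j, one degree lower. *)
Lemma kos_acyclic j i (w : E) : (j <= p)%N -> kge i w -> (d + j < i + p)%N ->
  kinR (I j) (kd y w) -> exists2 v : E, kge i.+1 v & kinR (I j) (w - kd y v).
Proof.
move=> /subnKC; move: (p - j)%N => k; elim: k j i w => [|k IH] j i w.
  rewrite addn0 => <- gw; rewrite ltn_add2r => di _.
  exists 0; first exact: submod0.
  by rewrite (kge_gt di gw) linear0 subrr; apply: submod0.
move=> ejk gw dj Idw; have jp : (j < p)%N by rewrite -ejk addnS ltnS leq_addr.
(* Modulo I_(j+1), [kwedge (c j) w] is a cycle one degree higher. Once it is written as kd y v + s_j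
   u modulo I_j, applying the differential and cancelling s_j gives w = kd y u modulo I_j. *)
have e : kd y (kwedge (c j) w) = s j *: w - kwedge (c j) (kd y w).
  by rewrite kd_kwedge sE.
have Ic : kinR (I j) (kwedge (c j) (kd y w)) by apply: kin_kwedge.
have [||||v gv Iv] := IH j.+1 i.+1 (kwedge (c j) w).
- by rewrite addSnnS.
- exact: kge_kwedge.
- by rewrite addnS addSn ltnS.
- by rewrite e; apply: submodB => //; [apply: kinSs | apply: kinS].
have [|u gu Iu] := kin_split1 (i := i.+1) jp _ Iv.
  by apply: submodB => //; [apply: kge_kwedge | apply: (kge_kd y gv)].
exists u => //; apply: (kin_reg jp); rewrite scalerBr.
have -> : s j *: w - s j *: kd y u =
    kd y (kwedge (c j) w - kd y v - s j *: u) + kwedge (c j) (kd y w).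
  by rewrite !klinE kd_kd e; module.
by apply: submodD => //; apply: kin_kd.
Qed.

(** With p > d the vanishing range for j = 0 includes degree 0, so 1 would be a combination of the
    [y i]. *)
Lemma regular_length_le (m : set R) : @submod R R^o m -> ~ m 1 ->
  (forall i, m (y i)) -> (p <= d)%N.
Proof.
move=> sm m1 my; rewrite leqNgt; apply/negP => dp.
have [||||v _] := @kos_acyclic 0 0 (kone d (1 : R^o)) => //.
- exact: kge0.
- by rewrite addn0 add0n.
- by rewrite kd_kone; apply: submod0.
rewrite I0 => /kin0 /(congr1 (@kbot _ _ _)).
rewrite linearB linear0 /= kbot_kone => /subr0_eq e1; apply: m1; rewrite e1.
apply: (kbot_kd _ sm) => i t.
by rewrite [_ *: _]mulrC; apply: (submodZ t sm).
Qed.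

Section Top.
Hypothesis dp : d = p.

Definition ktheta j : E :=
  foldr (fun i => kwedge (c i)) (kone d (1 : R^o)) (rev (iota 0 j)).

Lemma kthetaS j : ktheta j.+1 = kwedge (c j) (ktheta j).
Proof. by rewrite /ktheta -addn1 iotaD rev_cat. Qed.

Lemma kge_ktheta j : kge j (ktheta j).
Proof.
elim: j => [|j IH]; first exact: kge0.
by rewrite kthetaS; apply: kge_kwedge.
Qed.

Lemma kin_kd_ktheta j : (j <= p)%N -> kinR (I j) (kd y (ktheta j)).
Proof.
elim: j => [|j IH] jp; first by rewrite kd_kone; apply: submod0.
rewrite kthetaS kd_kwedge -sE //; apply: submodB => //; first exact: kinSs.
by apply: kin_kwedge => //; apply: kinS => //; apply: IH; apply: ltnW.
Qed.

(* The Koszul homology of [y] on R / I_j in degree j is generated by the product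
   of the cycles attached to s_0, ..., s_(j-1). *)
Lemma kos_top_generated j (w : E) : (j <= p)%N -> kge j w -> kinR (I j) (kd y w) ->
  exists a u, kge j.+1 u /\ kinR (I j) (w - a *: ktheta j - kd y u).
Proof.
elim: j w => [|j IH] w jp gw Idw.
  have [||||u gu Iu] := @kos_acyclic 0 1 (w - kone d (kbot w)) => //.
  - exact: kge_kbot.
  - by rewrite addn0 add1n ltnS dp.
  - by rewrite linearB /= kd_kone subr0.
  exists (kbot w), u; split; first exact: kge_leq gu.
  suff <- : kone d (kbot w) = kbot w *: ktheta 0 by [].
  by rewrite /ktheta /= -koneZ [_ *: _]mulr1.
have [v gv Iv] := kin_split1 jp (kge_kd y gw) Idw.
set t := kd y w - s j *: v in Iv.
have Idv : kinR (I j) (kd y v).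
  apply: (kin_reg jp); have -> : s j *: kd y v = - kd y t.
    by rewrite !klinE kd_kd; module.
  by apply: submodN => //; apply: kin_kd.
have [a [u [gu Iu]]] := IH v (ltnW jp) gv Idv.
set t' := v - a *: ktheta j - kd y u in Iu.
pose w' := w - a *: ktheta j.+1 - s j *: u.
have [||||x gx Ix] := @kos_acyclic j j.+1 w'.
- exact: ltnW.
- by apply: submodB => //; [apply: submodB => //; apply: submodZ => //; apply: kge_ktheta
                           | apply: submodZ].
- by rewrite dp addnC ltnS.
- have -> : kd y w' = s j *: t' + t + a *: kwedge (c j) (kd y (ktheta j)).
    by rewrite /w' kthetaS !klinE kd_kwedge -sE // /t' /t; module.
  apply: submodD => //; first by apply: submodD => //; apply: submodZ.
  by apply: submodZ => //; apply: kin_kwedge => //; apply: kin_kd_ktheta; apply: ltnW.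
exists a, x; split=> //.
have -> : w - a *: ktheta j.+1 - kd y x = s j *: u + (w' - kd y x).
  by rewrite /w'; module.
by apply: submodD => //; [apply: kinSs | apply: kinS].
Qed.

(** Such a v times the top basis vector is a cycle modulo I_p, hence a multiple of [ktheta p] up to
    boundaries from degree d + 1, which are zero. By [kprod_det], [ktheta p] is a determinant; its
    rows come in reverse order because each new factor is multiplied on the left. *)
Lemma regular_socle v : (forall i, I p (y i * v)) ->
  exists a, I p (v - a * \det (\matrix_(i, j) c (rev_ord i) j)).
Proof.
move=> yv; have [|||a [u [gu Iu]]] := @kos_top_generated p (ktop d (v : R^o)) => //.
- by rewrite -{1}dp; apply: kge_ktop.
- by apply: kin_kd_ktop => // i; apply: yv.
exists a; move: Iu; rewrite [u](kge_gt _ gu) ?dp // linear0 subr0.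
set M := \matrix_(i, j) _.
have -> : ktheta p = ktop d (\det M : R^o).
  have := kprod_det (V := R^o) M 1; rewrite [_ *: _]mulr1 => <-.
  rewrite /ktheta /kprod.
  have -> : rev (iota 0 p) = [seq nat_of_ord (rev_ord i) | i <- enum 'I_d].
    apply: (@eq_from_nth _ 0%N).
      by rewrite size_rev size_iota size_map size_enum_ord dp.
    rewrite size_rev size_iota => i ip; have id : (i < d)%N by rewrite dp.
    rewrite (nth_map (Ordinal id)) ?size_enum_ord // nth_rev ?size_iota //.
    rewrite nth_iota /=; last by rewrite ltn_subrL (leq_trans _ ip).
    by rewrite add0n nth_enum_ord // dp.
  rewrite foldr_map; congr (foldr _ _ _); apply/funext => i; congr (kwedge _).
  by apply/funext => j; rewrite mxE.
by rewrite -ktopZ -linearB /= => /kin_klast; rewrite klast_ktop.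
Qed.

End Top.

Fixpoint kcoef n : kos R^o n -> 'I_n -> R :=
  match n with
  | 0 => fun _ _ => 0
  | n'.+1 => fun w i => if unlift ord0 i is Some j then kcoef w.1 j else kbot w.2
  end.

Lemma kcoef0 n (w : kos R^o n.+1) : kcoef w ord0 = kbot w.2.
Proof. by rewrite /= unlift_none. Qed.

Lemma kcoefS n (w : kos R^o n.+1) j : kcoef w (lift ord0 j) = kcoef w.1 j.
Proof. by rewrite /= liftK. Qed.

Lemma kcoefD n (u v : kos R^o n) i : kcoef (u + v) i = kcoef u i + kcoef v i.
Proof.
elim: n u v i => [|n IH] u v i; first by case: i.
case: (unliftP ord0 i) => [j ->|->]; first by rewrite !kcoefS IH.
by rewrite !kcoef0 linearD.
Qed.

Lemma kcoefZ n a (u : kos R^o n) i : kcoef (a *: u) i = a * kcoef u i.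
Proof.
elim: n u i => [|n IH] u i; first by case: i.
case: (unliftP ord0 i) => [j ->|->]; first by rewrite !kcoefS IH.
by rewrite !kcoef0 linearZ.
Qed.

Lemma kcoef_kwedge n (b : 'I_n -> R) i : kcoef (kwedge b (kone n (1 : R^o))) i = b i.
Proof.
elim: n b i => [|n IH] b i; first by case: i.
case: (unliftP ord0 i) => [j ->|->]; first by rewrite kcoefS IH.
by rewrite kcoef0 /= linear0 subr0 linearZ /= kbot_kone [_ *: _]mulr1.
Qed.

Lemma kbot_kd_kcoef n (x : 'I_n -> R) (w : kos R^o n) :
  kbot (kd x w) = \sum_i x i * kcoef w i.
Proof.
elim: n x w => [|n IH] x w; first by rewrite big_ord0.
rewrite big_ord_recl kcoef0 /= linearD linearZ /= IH addrC; congr (_ + _).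
by apply: eq_bigr => i _; rewrite liftK.
Qed.

(** The degree 1 part of a boundary comes from degree 2, so it is a combination of Koszul syzygies
    x_i e_j - x_j e_i; [h] carries their coefficients for i < j and is 0 elsewhere. *)
Lemma kcoef_kd n (x : 'I_n -> R) (w : kos R^o n) : exists h : 'I_n -> 'I_n -> R,
  forall j, kcoef (kd x w) j = \sum_i x i * (h i j - h j i).
Proof.
elim: n x w => [|n IH] x w; first by exists (fun _ _ => 0); case.
have [h hP] := IH (tl x) w.1.
exists (fun i j => match unlift ord0 i, unlift ord0 j with
  | None, Some j' => kcoef w.2 j' | Some i', Some j' => h i' j' | _, _ => 0 end).
move=> j; rewrite big_ord_recl unlift_none; case: (unliftP ord0 j) => [j' ->|->].
  rewrite kcoefS /= kcoefD kcoefZ hP subr0 addrC; congr (_ + _).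
  by apply: eq_bigr => i _; rewrite liftK.
rewrite kcoef0 /= linearN /= kbot_kd_kcoef subr0 mulr0 add0r -sumrN.
by apply: eq_bigr => i _; rewrite liftK sub0r mulrN.
Qed.

(** Since d = p, the vanishing range for j = 0 starts in degree 1, so every syzygy of [y] is
    Koszul. *)
Lemma regular_syzygy (b : 'I_d -> R) : d = p -> \sum_i b i * y i = 0 ->
  exists h : 'I_d -> 'I_d -> R, forall j, b j = \sum_i y i * (h i j - h j i).
Proof.
move=> dp by0; have [||||v _] := @kos_acyclic 0 1 (kwedge b (kone d (1 : R^o))) => //.
- by apply: kge_kwedge; apply: kge0.
- by rewrite addn0 add1n dp.
- by rewrite kd_kwedge by0 scale0r kd_kone linear0 subr0; apply: submod0.
rewrite I0 => /kin0 /subr0_eq e; have [h hP] := kcoef_kd y v.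
by exists h => j; rewrite -hP -e kcoef_kwedge.
Qed.

End KoszulRegular.

(** * Krull's height theorem *)

Section KrullHeight.
Variable R : comNzRingType.
Implicit Types (I m : set R).

Lemma idealD I x y : ideal I -> I x -> I y -> I (x + y).
Proof. by case=> _ + _; apply. Qed.

Lemma idealM I a x : ideal I -> I x -> I (a * x).
Proof. by case=> _ _; apply. Qed.

Lemma idealMr I a x : ideal I -> I x -> I (x * a).
Proof. by rewrite mulrC; apply: idealM. Qed.

Lemma idealN I x : ideal I -> I x -> I (- x).
Proof. by move=> iI; rewrite -mulN1r; apply: idealM. Qed.

Lemma idealB I x y : ideal I -> I x -> I y -> I (x - y).
Proof. by move=> iI Ix Iy; apply: idealD => //; apply: idealN. Qed.

Lemma ideal_subK I x y : ideal I -> I y -> I (x - y) -> I x.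
Proof. by move=> iI Iy Ixy; rewrite -(subrK y x); apply: idealD. Qed.

Lemma ideal_pow_ideal I n : ideal (ideal_pow I n).
Proof. by case: n => [|n]; [split | apply: (@span_submod R R^o)]. Qed.

Lemma ideal_powS I n x y : I x -> ideal_pow I n y -> ideal_pow I n.+1 (x * y).
Proof. by move=> Ix Iy; apply: (@smulI R R^o). Qed.

Lemma ideal_powX I n x : I x -> ideal_pow I n (x ^+ n).
Proof. by move=> Ix; elim: n => // n IH; rewrite exprS; apply: ideal_powS. Qed.

Lemma ideal_pow_decr I n : ideal_pow I n.+1 `<=` ideal_pow I n.
Proof.
apply: (@smul_min R R^o); first exact: ideal_pow_ideal.
by move=> a x _ Ix; apply: idealM => //; apply: ideal_pow_ideal.
Qed.

Lemma prime_expr (p : set R) x n : prime_ideal p -> p (x ^+ n) -> p x.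
Proof.
move=> [_ p1 pM]; elim: n => [|n IH]; first by rewrite expr0.
by rewrite exprS => /pM[].
Qed.

Hypothesis noeR : noetherian R.

(** A maximal member among the ideals (I : x) with x outside I is prime: an associated prime of R /
    I. *)
Lemma prime_annihilator I : ideal I -> ~ I 1 ->
  exists x, ~ I x /\ prime_ideal [set a | I (a * x)].
Proof.
move=> iI I1; have iC x : ideal [set a | I (a * x)].
  split=> /=; first by rewrite mul0r; case: iI.
  - by move=> a b ? ?; rewrite mulrDl; apply: idealD.
  - by move=> a b ?; rewrite -mulrA; apply: idealM.
have [|J [iJ [x [nIx eJ]] maxJ]] := @noetherian_max _ noeR
    [set J | exists x, ~ I x /\ J = [set a | I (a * x)]].
  by exists [set a | I (a * 1)]; split=> //; exists 1.
exists x; split=> //; split=> //=; first by rewrite mul1r.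
move=> y z Iyzx; have [Izx|nIzx] := pselect (I (z * x)); [by right|left].
suff : J y by rewrite eJ.
apply: (maxJ [set a | I (a * (z * x))]) => //; first by exists (z * x).
- by rewrite eJ => a /= Iax; rewrite mulrCA; apply: idealM.
- by rewrite /= mulrA.
Qed.

(** * Krull's principal ideal theorem modulo a prime p0 *)

Section PrincipalIdeal.
Variables (p0 p1 p2 : set R) (a : R).
Hypotheses (P0 : prime_ideal p0) (P1 : prime_ideal p1) (P2 : prime_ideal p2).
Hypotheses (p01 : p0 `<` p1) (p12 : p1 `<` p2) (p2a : p2 a) (p1a : ~ p1 a).
Hypothesis p2min : forall q, prime_ideal q -> p0 `<=` q -> q a -> q `<=` p2 ->
  p2 `<=` q.

Let i0 : ideal p0. Proof. by case: P0. Qed.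
Let i1 : ideal p1. Proof. by case: P1. Qed.
Let i2 : ideal p2. Proof. by case: P2. Qed.
Let p0M x y : p0 (x * y) -> p0 x \/ p0 y. Proof. by case: P0 => _ _; apply. Qed.
Let p1M x y : p1 (x * y) -> p1 x \/ p1 y. Proof. by case: P1 => _ _; apply. Qed.
Let p2M x y : p2 (x * y) -> p2 x \/ p2 y. Proof. by case: P2 => _ _; apply. Qed.
Let p2n1 : ~ p2 1. Proof. by case: P2. Qed.
Let p1n1 : ~ p1 1. Proof. by case: P1. Qed.

Let W n : set R := [set x | exists2 y, ideal_pow p1 n y & p0 (x - y)].
(* The symbolic powers of p1 modulo p0. *)
Let S n : set R := [set x | exists2 u, ~ p1 u & W n (u * x)].
(** The contraction to R of the localization of J + (a) at p2. *)
Let U (J : set R) : set R := [set x | exists2 t, ~ p2 t & exists z, J (t * x - a * z)].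

Let W_ideal n : ideal (W n).
Proof.
have ip := ideal_pow_ideal p1 n; split.
- by exists 0; [case: ip | rewrite subr0; case: i0].
- move=> x y [x' ? ?] [y' ? ?]; exists (x' + y'); first exact: idealD.
  by rewrite opprD addrACA; apply: idealD.
- move=> b x [x' ? ?]; exists (b * x'); first exact: idealM.
  by rewrite -mulrBr; apply: idealM.
Qed.

Let S_ideal n : ideal (S n).
Proof.
have iW := W_ideal n; split.
- by exists 1 => //; rewrite mulr0; case: iW.
- move=> x y [u nu Wu] [v nv Wv]; exists (u * v); first by case/p1M.
  have -> : u * v * (x + y) = v * (u * x) + u * (v * y) by ring.
  by apply: idealD => //; apply: idealM.
- move=> b x [u nu Wu]; exists u => //.
  by rewrite mulrCA; apply: idealM.
Qed.

Let p0S n : p0 `<=` S n.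
Proof.
move=> x p0x; exists 1 => //; exists 0; first by case: (ideal_pow_ideal p1 n).
by rewrite mul1r subr0.
Qed.

Let S_decr n : S n.+1 `<=` S n.
Proof.
by move=> x [u nu [y /ideal_pow_decr ? ?]]; exists u => //; exists y.
Qed.

Let S_sat n u x : ~ p1 u -> S n (u * x) -> S n x.
Proof.
move=> nu [v nv Wv]; exists (v * u); first by case/p1M.
by rewrite -mulrA.
Qed.

Let sub12 x : ~ p2 x -> ~ p1 x. Proof. by move=> h /(p12.1). Qed.

Let U_ideal J : ideal J -> ideal (U J).
Proof.
move=> iJ; split.
- by exists 1 => //; exists 0; rewrite !mulr0 subrr; case: iJ.
- move=> x y [u nu [z Ju]] [v nv [t Jv]]; exists (u * v); first by case/p2M.
  exists (v * z + u * t).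
  have -> : u * v * (x + y) - a * (v * z + u * t) =
    v * (u * x - a * z) + u * (v * y - a * t) by ring.
  by apply: idealD => //; apply: idealM.
- move=> b x [u nu [z Ju]]; exists u => //; exists (b * z).
  have -> : u * (b * x) - a * (b * z) = b * (u * x - a * z) by ring.
  exact: idealM.
Qed.

Let U_sat J t x : ~ p2 t -> U J (t * x) -> U J x.
Proof.
move=> nt [u nu [z Jz]]; exists (u * t); first by case/p2M.
by exists z; rewrite -mulrA.
Qed.

Let U_mono J K : J `<=` K -> U J `<=` U K.
Proof. by move=> JK x [u nu [z /JK ?]]; exists u => //; exists z. Qed.

Let Ua J : ideal J -> U J a.
Proof. by move=> iJ; exists 1 => //; exists 1; rewrite mul1r mulr1 subrr; case: iJ. Qed.

Let subU J : J `<=` U J.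
Proof. by move=> x Jx; exists 1 => //; exists 0; rewrite mulr0 subr0 mul1r. Qed.

Let Un n := U (S n).
Let Un_ideal n : ideal (Un n). Proof. exact: U_ideal. Qed.
Let Un_decr n : Un n.+1 `<=` Un n. Proof. exact: U_mono. Qed.

Let Un_le n k : (n <= k)%N -> Un k `<=` Un n.
Proof.
move=> /subnKC <-; elim: (k - n)%N => [|j IH]; rewrite ?addn0 // addnS.
exact: subset_trans (@Un_decr _) IH.
Qed.

(* Locally at p2, the chain [Un] is stationary on J. *)
Let stable J := exists n0, forall n, (n0 <= n)%N -> Un n `&` J `<=` Un n.+1.

(** Locally at p2 the quotient of I + R x by I has length at most one, so the chain induces in it a
    sequence that drops at most once; [Q n] says that at step n the chain still fills it. *)
Let stable_ext I x : ideal I -> stable I -> (forall b, p2 b -> I (b * x)) ->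
  stable [set z | exists b, exists2 y, I y & z = b * x + y].
Proof.
move=> iI [n0 st] p2x.
pose Q n := exists c, ~ p2 c /\ exists2 y, I y & Un n (c * x + y).
have [Qall|] := pselect (forall n, Q n).
  exists n0 => n n0n z [Uz [b [y Iy ez]]]; rewrite {z}ez in Uz *.
  have [c [nc [y' Iy' Uc]]] := Qall n.+1.
  apply: (U_sat nc).
  have -> : c * (b * x + y) = b * (c * x + y') + (c * y - b * y') by ring.
  apply: idealD; [exact: Un_ideal|by apply: (idealM _ (Un_ideal _))|apply: st => //; split].
    have -> : c * y - b * y' = c * (b * x + y) - b * (c * x + y') by ring.
    by apply: (idealB (Un_ideal _)); apply: (idealM _ (Un_ideal _)) => //; apply: Un_decr.
  by apply: idealB => //; apply: idealM.
move=> /existsNP[n1 nQ]; exists (maxn n0 n1) => n.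
rewrite geq_max => /andP[n0n n1n] z [Uz [b [y Iy ez]]]; rewrite {z}ez in Uz *.
apply: st => //; split=> //; have [p2b|np2b] := pselect (p2 b).
  by apply: idealD => //; apply: p2x.
by case: nQ; exists b; split=> //; exists y => //; apply: (Un_le n1n).
Qed.

(** In substance, the finite length of R / (p0 + (a)) at p2. Take I maximal among the ideals that
    contain [U p0] and are stable. If it is proper, it is saturated at p2, so an associated prime of
    it lies in p2; containing p0 and a, that prime is p2 by minimality, and I can be enlarged. *)
Let stableT : stable setT.
Proof.
have VUn n : U p0 `<=` Un n by apply: U_mono; apply: p0S.
have [|I [iI [VI stI]] maxI] := @noetherian_max _ noeR [set I | U p0 `<=` I /\ stable I].
  exists (U p0); split; first exact: U_ideal.
  by split=> //; exists 0%N => n _ x [_ /VUn].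
have [I1|nI1] := pselect (I 1).
  case: stI => n0 st; exists n0 => n n0n x [Ux _]; apply: st => //; split=> //.
  by rewrite -(mulr1 x); apply: idealM.
have satI t x : ~ p2 t -> I (t * x) -> I x.
  move=> nt Itx; apply: (maxI [set x | exists2 t, ~ p2 t & I (t * x)]); last by exists t.
  - split; first by exists 1; rewrite ?mulr0 //; case: iI.
    + move=> b c [u nu Iu] [v nv Iv]; exists (u * v); first by case/p2M.
      have -> : u * v * (b + c) = v * (u * b) + u * (v * c) by ring.
      by apply: idealD => //; apply: idealM.
    + by move=> b c [u nu Iu]; exists u => //; rewrite mulrCA; apply: idealM.
  - split; first by move=> z /VI ?; exists 1; rewrite ?mul1r.
    case: stI => n0 st; exists n0 => n n0n z [Uz [u nu Iu]].
    by apply: (U_sat nu); apply: st => //; split=> //; apply: idealM.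
  - by move=> z Iz; exists 1; rewrite ?mul1r.
have [x [nIx pq]] := prime_annihilator iI nI1.
exfalso; apply: (nIx); apply: (maxI [set z | exists b, exists2 y, I y & z = b * x + y]).
- split; first by exists 0, 0; rewrite ?mul0r ?addr0 //; case: iI.
  + move=> _ _ [b [y Iy ->]] [c [z Iz ->]]; exists (b + c), (y + z).
      exact: idealD.
    by ring.
  + move=> t _ [b [y Iy ->]]; exists (t * b), (t * y); first exact: idealM.
    by ring.
- split; first by move=> z /VI Iz; exists 0, z; rewrite ?mul0r ?add0r.
  apply: stable_ext => //; apply: p2min => //.
  + by move=> z p0z; apply: idealMr => //; apply: VI; apply: subU.
  + by apply: idealMr => //; apply: VI; apply: Ua.
  + move=> b Ibx; apply: contrapT => nb.
    exact/nIx/(satI b).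
- by move=> z Iz; exists 0, z; rewrite ?mul0r ?add0r.
- by exists 1, 0; rewrite ?mul1r ?addr0 //; case: iI.
Qed.

(** Stationarity puts S_n, locally at p2, into a S_n + S_(n+1), because a lies outside p1 and S_n is
    saturated there. Nakayama at p2 gives S_n = S_(n+1); Nakayama at p1 then puts p1^n into p0, so
    that p1 would equal p0. *)
Lemma principal_ideal_absurd : False.
Proof.
have [n st] := stableT.
have SU : S n `<=` Un n.+1 by move=> x Sx; apply: (st n) => //; split=> //; apply: subU.
have SS : S n `<=` S n.+1.
  have [k [g eS]] := noeR (S_ideal n).
  rewrite eS; apply: (@span_range_sub R R^o); first exact: S_ideal.
  apply: (@nakayama_prime R R^o p2) => //; first exact: S_ideal.
    by move=> t x /sub12; apply: S_sat.
  move=> i; have Sg : S n (g i) by rewrite eS; apply: mem_span_range.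
  have [t nt [z Sz]] := SU _ Sg.
  have /(S_sat p1a) : S n (a * z).
    have -> : a * z = t * g i - (t * g i - a * z) by ring.
    by apply: idealB => //; [apply: idealM | apply: S_decr].
  rewrite eS => /span_rangeP[c ez]; exists t, (fun j => a * c j); split=> //.
    by move=> j; apply: idealMr.
  suff <- : a * z = \sum_j (a * c j) *: g j by [].
  by rewrite ez mulr_sumr; apply: eq_bigr => j _; rewrite /GRing.scale /= mulrA.
have pp0 : ideal_pow p1 n `<=` p0.
  have [k [g eg]] := noeR (ideal_pow_ideal p1 n).
  rewrite eg; apply: (@span_range_sub R R^o) => //.
  apply: (@nakayama_prime R R^o p1) => //.
    by move=> t x nt /p0M[/(p01.1)|].
  move=> i; have Pg : ideal_pow p1 n (g i) by rewrite eg; apply: mem_span_range.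
  have [u nu [v Pv p0uv]] : S n.+1 (g i).
    apply: SS; exists 1 => //; exists (g i) => //.
    by rewrite mul1r subrr; case: i0.
  have : @smul R R^o p1 (span (range g)) v by rewrite -eg.
  by move=> /(smul_rangeP i1)[c [pc ev]]; exists u, c; split=> //; rewrite -ev.
case: p01 => _; apply=> x p1x; apply: (prime_expr (n := n) P0).
by apply: pp0; apply: ideal_powX.
Qed.

End PrincipalIdeal.

(** If no such q existed, p2 would be minimal over p0 + (a) while p1 avoids a, which the principal
    ideal theorem excludes. *)
Lemma prime_between (p0 p1 p2 : set R) a : prime_ideal p0 -> prime_ideal p1 ->
  prime_ideal p2 -> p0 `<` p1 -> p1 `<` p2 -> p2 a ->
  exists q, [/\ prime_ideal q, p0 `<` q, q `<` p2 & q a].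
Proof.
move=> P0 P1 P2 p01 p12 p2a.
have [p1a|np1a] := pselect (p1 a); first by exists p1.
apply: contrapT => nq; apply: (principal_ideal_absurd P0 P1 P2 p01 p12 p2a np1a).
move=> q Pq p0q qa qp2; apply: contrapT => np2q; apply: nq; exists q; split=> //.
by split=> // qp0; apply: np1a; apply: p01.1; apply: qp0.
Qed.

(** The element a is pushed down from the top, one intermediate prime being exchanged at a time; the
    cost is one step of length. *)
Lemma prime_chain_push (p : nat -> set R) n a : prime_chain p n.+1 -> p n.+1 a ->
  exists q, [/\ prime_chain q n, p 0%N `<=` q 0%N, q 0%N a & q n = p n.+1].
Proof.
elim: n p a => [|n IH] p a [Pp ltp] pa.
  exists (fun=> p 1%N); split=> //; first by split=> // i _; apply: Pp.
  by apply: (ltp 0%N _).1.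
have [q [Pq ltq qlt qa]] := prime_between (Pp n (leqW (leqnSn n)))
  (Pp n.+1 (leqnSn _)) (Pp n.+2 (leqnn _)) (ltp n (leqnSn _)) (ltp n.+1 (leqnn _)) pa.
have [||r [[Pr ltr] r0 ra rn]] := IH (fun i => if (i <= n)%N then p i else q) a.
- split=> i; first by case: (leqP i n) => [lein _|//]; apply: Pp; do 2 apply: leqW.
  rewrite ltnS => lein; rewrite lein; case: (ltnP i n) => [ltin|nltin].
    by apply: ltp; apply: leqW; apply: leqW.
  by have -> : i = n by apply/eqP; rewrite eqn_leq lein.
- by rewrite ltnn.
exists (fun i => if (i <= n)%N then r i else p n.+2); split=> //; last by rewrite ltnn.
split=> i.
  by case: (leqP i n) => [lein _|_ _]; [apply: Pr | apply: Pp].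
rewrite ltnS => lein; rewrite lein; case: (ltnP i n) => [ltin|nltin]; first exact: ltr.
have -> : i = n by apply/eqP; rewrite eqn_leq lein.
by move: rn; rewrite ltnn => ->.
Qed.

Lemma prime_chain_push_seq (s : seq R) (p : nat -> set R) n : prime_chain p n ->
  {in s, forall a, p n a} -> (size s <= n)%N ->
  exists q, [/\ prime_chain q (n - size s), p 0%N `<=` q 0%N,
    {in s, forall a, q 0%N a} & q (n - size s)%N = p n].
Proof.
elim: s p n => [|a s IH] p n cp ps sn; first by exists p; rewrite subn0; split.
case: n cp ps sn => // n cp ps; rewrite ltnS => sn.
have [|q [cq pq qa qn]] := prime_chain_push (a := a) cp; first by apply: ps; rewrite mem_head.
have [|//|r [cr qr rs rn]] := IH q n cq.
  by move=> b bs; rewrite qn; apply: ps; rewrite in_cons bs orbT.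
exists r; rewrite subSS; split=> //; last by rewrite rn.
- exact: subset_trans pq qr.
- by move=> b; rewrite in_cons => /orP[/eqP->|/rs //]; apply: qr.
Qed.

(** With the last prime replaced by m, the elements of s are pushed to the bottom at the cost of one
    step each. If the chain were longer than s, a strict inclusion would remain, yet its bottom
    prime contains m^N and so equals m. *)
Theorem krull_height m (s : seq R) N (p : nat -> set R) n : local_units m -> {in s, forall a, m a} ->
  ideal_pow m N `<=` ideal_gen [set` s] -> prime_chain p n -> (n <= size s)%N.
Proof.
move=> mL ms mNs cp; rewrite leqNgt; apply/negP => sn.
have [im m1 mU] := mL.
have Pm : prime_ideal m by split=> // x y; apply: local_prime.
have sub_m q : prime_ideal q -> q `<=` m.
  move=> [iq q1 _] x qx; apply: contrapT => /mU[y yx]; apply: q1.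
  by rewrite -yx; apply: idealM.
pose p' i := if (i < n)%N then p i else m.
case: cp => Pp ltp.
have cp' : prime_chain p' n.
  split=> i; first by rewrite leq_eqVlt /p' => /orP[/eqP->|lin];
    [rewrite ltnn | rewrite lin; apply: Pp; apply: ltnW].
  move=> lin; rewrite /p' lin; case: ifP => [lin'|_]; first exact: ltp.
  have [_ nip] := ltp _ lin; split; first by apply: sub_m; apply: Pp; apply: ltnW.
  by move=> mp; apply: nip; apply: subset_trans mp; apply: sub_m; apply: Pp.
have [|q [[Pq ltq] _ qs qn]] := prime_chain_push_seq cp' _ (ltnW sn).
  by move=> a /ms; rewrite /p' ltnn.
have mq : m `<=` q 0%N.
  move=> x mx; apply: (prime_expr (n := N) (Pq 0%N (leq0n _))).
  have /mNs : ideal_pow m N (x ^+ N) by apply: ideal_powX.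
  by apply: (@span_min R R^o) => //; case: (Pq 0%N (leq0n _)).
have /ltq[q01 nq10] : (0 < n - size s)%N by rewrite subn_gt0.
apply: nq10; apply: subset_trans mq; apply: sub_m; apply: Pq.
by rewrite subn_gt0.
Qed.

End KrullHeight.

(** * Complete intersections *)

Section CompleteIntersectionData.
Variable C : comNzRingType.

(* For generators x of the maximal ideal: the rows of z generate the syzygies of
   x modulo the Koszul ones, and det z generates the socle. *)
Definition ci_matrix n (x : 'cV[C]_n) (z : 'M[C]_n) : Prop :=
  [/\ z *m x = 0,
      forall c : 'rV_n, c *m x = 0 -> exists (u : 'rV_n) (h : 'M_n),
        c = u *m z + x^T *m (h - h^T)
    & forall a, (forall i, x i 0 * a = 0) -> exists u, a = u * \det z].

Definition ci_gens n (x : 'cV[C]_n) : Prop := exists z, ci_matrix x z.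

(** Adjoining redundant generators x = P y adds the syzygies x - P y as rows and leaves the
    determinant unchanged. *)
Lemma ci_gens_add n k (y : 'cV[C]_n) (x : 'cV[C]_k) (P : 'M_(k, n)) :
  x = P *m y -> ci_gens y -> ci_gens (col_mx y x).
Proof.
move=> ex [z [zy syz soc]]; exists (block_mx z 0 (- P) 1%:M); split.
- rewrite mul_block_col zy mul0mx add0r mul1mx ex mulNmx addNr.
  by rewrite col_mx0.
- move=> c; rewrite -[c]hsubmxK; set c1 := lsubmx c; set c2 := rsubmx c.
  rewrite mul_row_col ex mulmxA -mulmxDl => /syz[u [h e]].
  exists (row_mx u c2), (block_mx h 0 0 0).
  rewrite mul_row_block mulmx0 add0r mulmx1 mulmxN tr_col_mx tr_block_mx !trmx0.
  rewrite opp_block_mx add_block_mx !subr0 mul_row_block !mulmx0 !addr0.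
  rewrite add_row_mx addr0; congr (row_mx _ _).
  by rewrite -[LHS](addrK (c2 *m P)) e addrAC.
- move=> a xa; have [|u ->] := soc a.
    by move=> i; have := xa (lshift k i); rewrite col_mxEu.
  by exists u; rewrite det_lblock det1 mulr1.
Qed.

(** The redundancy of [x 0 0] is a syzygy with coefficient -1 there. Koszul syzygies have entries in
    m, so some entry in the first column of z is a unit; reducing with that pivot allows its row and
    the column to be deleted. *)
Lemma ci_gens_remove (m : set C) n (x : 'cV[C]_n.+1) (c : 'rV_n) : local_units m ->
  (forall i, m (x i 0)) -> x 0 0 = \sum_j c 0 j * x (lift 0 j) 0 ->
  ci_gens x -> ci_gens (\col_(j < n) x (lift 0 j) 0).
Proof.
move=> [im m1 mU] mx ex [z [zx syz soc]].
pose c0 : 'rV[C]_n.+1 := \row_i if unlift 0 i is Some j then c 0 j else -1.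
have c00 : c0 0 0 = -1 by rewrite mxE unlift_none.
have [|u [h eu]] := syz c0.
  apply/matrixP => i j; rewrite !mxE big_ord_recl !mxE unlift_none mulN1r.
  rewrite [j]ord1 ex addrC; apply/eqP; rewrite subr_eq0; apply/eqP.
  by apply: eq_bigr => k _; rewrite !mxE liftK.
have [i nzi] : exists i, ~ m (z i 0).
  apply: contrapT => /forallNP mz; apply: m1.
  suff : m (- 1) by move/(idealN im); rewrite opprK.
  rewrite -c00 eu !mxE; apply: idealD => //.
    by apply: (@submod_sum C C^o) => // k _; apply: idealM => //; exact: contrapT (mz k).
  apply: (@submod_sum C C^o) => // k _; rewrite mulrC; apply: idealM im _.
  by rewrite mxE.
have [v vz] := mU _ nzi.
(* Row reduction with pivot [z i 0]: [T] undoes it, and only row i of [z2] keeps an entry in the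
   first column. *)
pose w k := if k == i then 0 else z k 0 * v.
pose z2 : 'M[C]_n.+1 := \matrix_(k, l) (z k l - w k * z i l).
pose T : 'M[C]_n.+1 := 1%:M + \matrix_(k, l) (w k * (l == i)%:R).
have wi : w i = 0 by rewrite /w eqxx.
have z2i l : z2 i l = z i l by rewrite mxE wi mul0r subr0.
have Tz2 : T *m z2 = z.
  apply/matrixP => k l; rewrite mulmxDl mul1mx !mxE (bigD1 i) //= big1 => [|j /negbTE ji].
    by rewrite !mxE eqxx wi mulr1 mul0r subr0 addr0 subrK.
  by rewrite !mxE ji mulr0 mul0r.
have z20 k : k != i -> z2 k 0 = 0.
  by move=> /negbTE ki; rewrite mxE /w ki -mulrA vz mulr1 subrr.
pose z' : 'M[C]_n := row' i (col' 0 z2).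
have detz2 : \det z2 = z i 0 * ((-1) ^+ i * \det z').
  rewrite (expand_det_col z2 0) (bigD1 i) //= big1 => [|k ki].
    by rewrite addr0 z2i /cofactor addn0.
  by rewrite z20 ?mul0r.
have z2x : z2 *m x = 0.
  apply/matrixP => k l; rewrite !mxE.
  have zE q : \sum_j z q j * x j l = 0.
    by have /matrixP/(_ q l) := zx; rewrite !mxE.
  transitivity (\sum_j z k j * x j l - w k * \sum_j z i j * x j l).
    rewrite mulr_sumr -sumrB; apply: eq_bigr => j _; rewrite mxE; ring.
  by rewrite !zE mulr0 subr0.
exists z'; split.
- apply/matrixP => k l; rewrite [l]ord1 !mxE.
  have /matrixP/(_ (lift i k) 0) := z2x; rewrite !mxE big_ord_recl.
  rewrite z20 ?mul0r ?add0r; last by rewrite eq_sym neq_lift.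
  by move=> e; rewrite -[RHS]e; apply: eq_bigr => j _; rewrite !mxE.
- move=> t tx.
  pose t0 : 'rV[C]_n.+1 := \row_q if unlift 0 q is Some j then t 0 j else 0.
  have [|b [g eb]] := syz t0.
    apply/matrixP => p q; rewrite !mxE big_ord_recl !mxE unlift_none mul0r add0r.
    have /matrixP/(_ p q) := tx; rewrite !mxE => e; rewrite -[RHS]e.
    by apply: eq_bigr => k _; rewrite !mxE liftK [p]ord1 [q]ord1.
  pose d := b *m T; pose A := g - g^T.
  have Aanti p q : A p q = - A q p by rewrite !mxE opprB.
  have eb' q : t0 0 q = \sum_k d 0 k * z2 k q + \sum_p x p 0 * A p q.
    rewrite eb -Tz2 mulmxA !mxE; congr (_ + _).
    by apply: eq_bigr => p _; rewrite !mxE.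
  (* The extended syzygy has first coordinate 0, which determines the coefficient [d 0 i] of the
     pivot row from the Koszul part. That row and the terms in [x 0 0] then combine into Koszul
     syzygies of the remaining generators. *)
  pose om := \sum_(p < n) x (lift 0 p) 0 * A (lift 0 p) 0.
  have d_om : d 0 i = - v * om.
    have := eb' 0; rewrite mxE unlift_none (bigD1 i) //= big1 => [|k ki]; last first.
      by rewrite z20 ?mulr0.
    rewrite addr0 z2i big_ord_recl -/om.
    have -> : A 0 0 = 0 by rewrite !mxE subrr.
    rewrite mulr0 add0r => /esym/eqP; rewrite addr_eq0 => /eqP e.
    by rewrite -[d 0 i]mulr1 -vz mulrCA e mulrN mulNr.
  have x0E : x 0 0 = - v * \sum_(p < n) z i (lift 0 p) * x (lift 0 p) 0.
    have /matrixP/(_ i 0) := zx; rewrite !mxE big_ord_recl => /eqP.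
    rewrite addr_eq0 => /eqP e.
    by rewrite mulNr -mulrN -e mulrA vz mul1r.
  exists (\row_k d 0 (lift i k)).
  exists (\matrix_(p, q) (v * z i (lift 0 p) * A (lift 0 q) 0 + g (lift 0 p) (lift 0 q))).
  apply/matrixP => p q; rewrite [p]ord1 !mxE.
  have := eb' (lift 0 q); rewrite mxE liftK => ->.
  rewrite (bigD1_ord i) //= z2i d_om big_ord_recl x0E (Aanti 0) -addrA addrCA.
  congr (_ + _); first by apply: eq_bigr => k _; rewrite !mxE.
  rewrite addrA; under [RHS]eq_bigr do rewrite !mxE.
  have -> : - v * om * z i (lift 0 q) = \sum_(p < n) - v * z i (lift 0 q) * (x (lift 0 p) 0 * A (lift 0 p) 0).
    by rewrite -mulr_sumr -/om; ring.
  have -> : - v * (\sum_(p < n) z i (lift 0 p) * x (lift 0 p) 0) * - A (lift 0 q) 0 =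
     \sum_(p < n) v * A (lift 0 q) 0 * (z i (lift 0 p) * x (lift 0 p) 0).
    by rewrite -mulr_sumr; ring.
  rewrite -!big_split; apply: eq_bigr => k _; rewrite !mxE /=; ring.
- move=> a xa; have [|b ->] := soc a.
    move=> q; case: (unliftP 0 q) => [j ->|->]; first by have := xa j; rewrite mxE.
    rewrite ex mulr_suml big1 // => j _; rewrite -mulrA.
    by have := xa j; rewrite mxE => ->; rewrite mulr0.
  exists (b * \det T * z i 0 * (-1) ^+ i).
  by rewrite -[in LHS]Tz2 det_mulmx detz2 !mulrA.
Qed.

(** Both systems generate the same ideal, so x can be adjoined to y and the members of y removed one
    by one. *)
Lemma ci_gens_exchange (m : set C) n k (y : 'cV[C]_n) (x : 'cV[C]_k) :
  local_units m -> (forall i, m (y i 0)) -> (forall i, m (x i 0)) ->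
  (forall a, m a -> exists c : 'rV_n, a = (c *m y) 0 0) ->
  (forall a, m a -> exists c : 'rV_k, a = (c *m x) 0 0) ->
  ci_gens y -> ci_gens x.
Proof.
move=> mL my mx gy gx ciy.
have /choice[P eP] i := gy _ (mx i).
have {ciy} : ci_gens (col_mx y x).
  apply: (ci_gens_add (P := \matrix_i P i)) ciy.
  by apply/matrixP => i j; rewrite [j]ord1 eP !mxE; apply: eq_bigr => l _; rewrite !mxE.
elim: n y my {gy P eP} => [|n IH] y my.
  have -> : col_mx y x = x; last by [].
  by apply/matrixP => i j; rewrite -[i](@splitK 0 k) /=; case: split => [[]//|l]; rewrite col_mxEd; congr (x _ _); apply: val_inj.
move=> ci; apply: (IH (\col_j y (lift 0 j) 0)); first by move=> i; rewrite mxE.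
have [c ec] := gx _ (my 0).
have := @ci_gens_remove m (n + k) (col_mx y x) (row_mx 0 c) mL _ _ ci.
have eS i : col_mx y x (lift 0 (lshift k i)) 0 = y (lift 0 i) 0.
  by have <- := col_mxEu y x (lift 0 i) 0; congr (col_mx y x _ _); apply: val_inj.
have eR i : col_mx y x (lift 0 (rshift n i)) 0 = x i 0.
  by have <- := col_mxEd y x i 0; congr (col_mx y x _ _); apply: val_inj.
move=> h; have : ci_gens (\col_j (col_mx y x : 'cV_(n + k).+1) (lift 0 j) 0).
  apply: h.
    move=> i; rewrite -[i](@splitK n.+1 k); case: split => j.
      by have -> := col_mxEu y x j 0.
    by have -> := col_mxEd y x j 0.
  have -> : (col_mx y x : 'cV_(n + k).+1) 0 0 = y 0 0.
    by have <- := col_mxEu y x 0 0; congr (col_mx y x _ _); apply: val_inj.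
  rewrite ec mxE big_split_ord /= [X in _ = X + _]big1 ?add0r => [|j _]; last by rewrite row_mxEl mxE mul0r.
  by apply: eq_bigr => j _; rewrite row_mxEr eR.
suff -> : \col_(j < n + k) (col_mx y x : 'cV_(n + k).+1) (lift 0 j) 0 =
  col_mx (\col_j y (lift 0 j) 0) x by [].
apply/matrixP => i j; rewrite [j]ord1 mxE.
by case: (split_ordP i) => l ->; rewrite ?eS ?eR ?col_mxEu ?col_mxEd ?mxE.
Qed.

End CompleteIntersectionData.

Lemma min_generatorsP (R : comNzRingType) (V : lmodType R) (N : set V) :
  finitely_generated N -> generated_by N (min_generators N) /\
  forall n, generated_by N n -> (min_generators N <= n)%N.
Proof.
move=> [n0 gN]; rewrite /min_generators; case: xgetP => [k -> //|nmin].
pose P k := `[< generated_by N k >].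
have exP : exists k, P k by exists n0; apply/asboolP.
case: (ex_minnP exP) => k /asboolP gk kmin; exfalso; apply: (nmin k); split=> // n gn.
by apply: kmin; apply/asboolP.
Qed.

Section IdealGenSeq.
Variable R : comNzRingType.

Lemma ideal_gen_ideal (X : set R) : ideal (ideal_gen X).
Proof. exact: (@span_submod R R^o). Qed.

Lemma mem_ideal_gen (X : set R) x : X x -> ideal_gen X x.
Proof. exact: (@sub_span R R^o). Qed.

Lemma ideal_gen_seqP (s : seq R) x :
  ideal_gen [set` s] x -> exists u : 'I_(size s) -> R, x = \sum_i u i * s`_i.
Proof.
have -> : ideal_gen [set` s] = @Defs.span R R^o (range (fun i : 'I_(size s) => s`_i)).
  rewrite /ideal_gen; congr (@Defs.span R R^o _); apply/seteqP; split=> [y /= ys|_ [i _ <-]].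
    have lt : (index y s < size s)%N by rewrite index_mem.
    by exists (Ordinal lt) => //=; rewrite nth_index.
  by rewrite /= mem_nth.
by move/(@span_rangeP R R^o) => [u ->]; exists u.
Qed.

Lemma ideal_gen_rcons (s : seq R) a x :
  ideal_gen [set` rcons s a] x <-> exists b, ideal_gen [set` s] (x - a * b).
Proof.
have iI := ideal_gen_ideal [set` s]; split=> [|[b h]]; last first.
  apply: (ideal_subK (y := a * b)); first exact: ideal_gen_ideal.
    apply: idealMr; first exact: ideal_gen_ideal.
    by apply: mem_ideal_gen; rewrite /= mem_rcons mem_head.
  apply: (@span_mono R R^o [set` s] _ _ _ h) => y /= ys.
  by rewrite mem_rcons in_cons ys orbT.
apply: (@span_min R R^o _ [set x | exists b, ideal_gen [set` s] (x - a * b)]).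
  split; first by exists 0; rewrite mulr0 subr0; case: iI.
  - move=> y z [b hb] [c hc]; exists (b + c).
    have -> : y + z - a * (b + c) = (y - a * b) + (z - a * c) by ring.
    exact: idealD.
  - move=> t y [b hb]; exists (t * b).
    have -> : t *: y - a * (t * b) = t * (y - a * b) by rewrite /GRing.scale /=; ring.
    exact: idealM.
move=> y /=; rewrite mem_rcons in_cons => /orP[/eqP->|ys].
  by exists 1; rewrite mulr1 subrr; case: iI.
by exists 0; rewrite mulr0 subr0; apply: mem_ideal_gen.
Qed.

Lemma ideal_gen_nil : ideal_gen [set` [::] : seq R] = [set 0].
Proof.
apply/seteqP; split=> [x /ideal_gen_seqP[u ->]|_ ->]; first by rewrite big_ord0.
by case: (ideal_gen_ideal [set` [::] : seq R]).
Qed.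

End IdealGenSeq.

(** The matrix expresses s in minimal generators of m_S. It is square: a regular sequence in m_S has
    at most d terms, and as (s) contains a power of m_S, the height theorem applied to a chain of
    length d = dim S gives at least d. *)
Lemma regular_quotient_ci (S C : comNzRingType) (mS : set S) (s : seq S)
    (q : {rmorphism S -> C}) N :
  regular_local mS -> regular_sequence s ->
  is_quotient_by (ideal_gen [set` s]) q ->
  ideal_pow mS N `<=` ideal_gen [set` s] ->
  exists d (y : 'cV[C]_d), [/\ ci_gens y,
    forall i, exists2 t, mS t & y i 0 = q t
  & forall t, mS t -> exists c : 'rV_d, q t = (c *m y) 0 0].
Proof.
move=> [nlS [[p cp] _]] [s1 sreg] [qsurj qker] mN.
have noeS := nlS.1; have mL := noetherian_local_units nlS.
have [im m1 mU] := mL.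
have [[y ey] _] := min_generatorsP (noeS _ im).
move: cp; rewrite /edim; move: (min_generators _) y ey => d y ey cp.
have my i : mS (y i) by rewrite ey; apply: mem_span_range.
have mE t : mS t -> exists c : 'I_d -> S, t = \sum_i c i * y i.
  by rewrite {1}ey => /span_rangeP[c ->]; exists c.
have ms : {in s, forall a, mS a}.
  move=> a sa; apply: contrapT => /mU[b ba]; apply: s1; rewrite -ba.
  by apply: (idealM _ (ideal_gen_ideal _)); apply: mem_ideal_gen.
pose I j := ideal_gen [set` take j s].
have sI j : @submod S S^o (I j) by apply: ideal_gen_ideal.
have I0 : I 0%N = [set 0] by rewrite /I take0 ideal_gen_nil.
have IS j v : (j < size s)%N -> I j.+1 v <-> exists a, I j (v - s`_j * a).
  by move=> js; rewrite /I (take_nth 0 js); apply: ideal_gen_rcons.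
have /choice[c cP] j : exists c : 'I_d -> S, (j < size s)%N -> s`_j = \sum_i c i * y i.
  have [js|] := ltnP j (size s); last by exists (fun=> 0).
  by have [c ->] := mE _ (ms _ (mem_nth 0 js)); exists c.
have reg j v : (j < size s)%N -> I j (s`_j * v) -> I j v by move=> js; apply: sreg.
have sd : (size s <= d)%N := regular_length_le sI I0 IS cP reg im m1 my.
have ds : (d <= size s)%N := krull_height noeS mL ms mN cp.
have e : d = size s by apply/eqP; rewrite eqn_leq ds sd.
have Is : I (size s) = ideal_gen [set` s] by rewrite /I take_size.
pose M : 'M[S]_d := \matrix_(i, j) c (rev_ord i) j.
have sM (i : 'I_d) : (rev_ord i < size s)%N by rewrite -e.
exists d, (\col_i q (y i)); split; last first.
- move=> t /mE[a ->]; exists (\row_i q (a i)); rewrite mxE rmorph_sum.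
  by apply: eq_bigr => i _; rewrite !mxE rmorphM.
- by move=> i; exists (y i) => //; rewrite mxE.
exists (map_mx q M); split.
- apply/matrixP => i j; rewrite !mxE; apply: etrans ((qker (s`_(rev_ord i))).2 _).
    rewrite (cP _ (sM i)) rmorph_sum; apply: eq_bigr => k _; by rewrite !mxE rmorphM.
  by apply: mem_ideal_gen; apply: mem_nth (sM i).
- move=> b by0; have /choice[b' b'P] i := qsurj (b 0 i).
  have : ideal_gen [set` s] (\sum_i b' i * y i).
    apply/qker; rewrite rmorph_sum; have /matrixP/(_ 0 0) := by0.
    rewrite !mxE => e0; rewrite -[RHS]e0; apply: eq_bigr => i _.
    by rewrite rmorphM b'P !mxE.
  move=> /ideal_gen_seqP; rewrite -e => -[u eu].
  (* The relation over C lifts to sum b' y = sum u s; subtracting u times the rows of [c] leaves a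
     true syzygy of y over S, which is Koszul. *)
  have [|h hP] := @regular_syzygy _ _ _ y _ c I sI I0 IS cP reg
    (fun j => b' j - \sum_i u i * c i j) e.
    rewrite -[RHS](subrr (\sum_i b' i * y i)) {2}eu -sumrB.
    under eq_bigr do rewrite mulrBl.
    rewrite !sumrB; congr (_ - _); under eq_bigr do rewrite mulr_suml.
    rewrite exchange_big; apply: eq_bigr => i _; rewrite (cP i) -?e // mulr_sumr.
    by apply: eq_bigr => j _; rewrite mulrA.
  exists (\row_i q (u (rev_ord i))), (\matrix_(i, j) q (h i j)).
  apply/matrixP => i j; rewrite [i]ord1 !mxE -b'P.
  have -> : b' j = \sum_i u i * c i j + \sum_i y i * (h i j - h j i).
    by rewrite -hP addrC subrK.
  rewrite rmorphD !rmorph_sum (reindex_inj rev_ord_inj) /=; congr (_ + _).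
    by apply: eq_bigr => k _; rewrite rmorphM !mxE.
  by apply: eq_bigr => k _; rewrite rmorphM rmorphB !mxE.
- move=> a; have [v <-] := qsurj a => ya.
  have [|b] := @regular_socle _ _ _ y _ c I sI IS cP reg e v.
    by move=> i; rewrite Is; apply/qker; rewrite rmorphM; have := ya i; rewrite mxE.
  rewrite Is => /qker; rewrite rmorphB rmorphM => /subr0_eq ->; exists (q b).
  by rewrite det_map_mx.
Qed.

(** * Counting generators *)

(** A coherent sequence is constant from index N on, so its limit is that of the constant sequence
    with value [u N]. *)
Lemma completion_nilpotent (F C : comNzRingType) (m : set F) N :
  ideal_pow m N `<=` [set 0] -> is_completion m C ->
  exists psi : {rmorphism F -> C}, bijective psi.
Proof.
move=> mN [lim [limD limM lim1 lim_surj lim0]].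
have pow_id n := ideal_pow_ideal m n.
have cst a : coherent m (fun=> a) by move=> n; rewrite subrr; case: (pow_id n).
pose psi a := lim (fun=> a).
have psiD a b : psi (a + b) = psi a + psi b by rewrite -limD.
have add : zmod_morphism psi.
  by move=> a b; have := psiD (a - b) b; rewrite subrK => ->; rewrite addrK.
have mul : monoid_morphism psi by split=> [|a b]; rewrite /psi ?lim1 // -limM.
pose addM := GRing.isZmodMorphism.Build F C psi add.
pose mulM := GRing.isMonoidMorphism.Build F C psi mul.
pose f : {rmorphism F -> C} := HB.pack psi addM mulM.
exists f; have f0 a : f a = 0 -> a = 0 by move=> /(lim0 _ (cst a))/(_ N)/mN.
have f_inj : injective f.
  by move=> a b e; apply/subr0_eq/f0; rewrite rmorphB e subrr.
have f_surj z : exists a, f a = z.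
  have [u cu <-] := lim_surj z; exists (u N).
  have ucauchy n j : ideal_pow m n (u (n + j)%N - u n).
    elim: j => [|j IH]; first by rewrite addn0 subrr; case: (pow_id n).
    have -> : u (n + j.+1)%N - u n = (u (n + j).+1 - u (n + j)%N) + (u (n + j)%N - u n).
      by rewrite addnS; ring.
    apply: idealD => //; elim: j {IH} => [|j IH]; first by rewrite addn0; apply: cu.
    have decr i : ideal_pow m (n + i)%N `<=` ideal_pow m n.
      elim: i => [|i IHi]; first by rewrite addn0.
      by rewrite addnS; apply: subset_trans IHi; apply: ideal_pow_decr.
    by apply: (decr j.+1); apply: cu.
  pose w n := u n - u N.
  have ew : coherent m w.
    by move=> n; have -> : w n.+1 - w n = u n.+1 - u n by [rewrite /w; ring]; apply: cu.
  have -> : lim u = lim (fun n => w n + u N).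
    by congr lim; apply/funext => n; rewrite subrK.
  rewrite limD //; have -> : lim w = 0; last by rewrite add0r.
  apply/(lim0 _ ew) => n; rewrite /w; have [nN|/ltnW Nn] := leqP n N.
    by rewrite -(subnKC nN) -opprB; apply: idealN.
  have /mN := ucauchy N (n - N)%N; rewrite subnKC // => ->.
  by case: (pow_id n).
have [g gK] := choice f_surj; exists g => // a; apply: f_inj; exact: gK.
Qed.

Section ResidueField.
Variables (A : comNzRingType) (m : set A) (k : fieldType) (pk : {rmorphism A -> k}).
Hypothesis hk : is_quotient_by m pk.

(** The coordinates of the independent [t] in terms of the [s] form a matrix over k with independent
    rows. If it is square it is invertible, and independence passes to the [s]. *)
Lemma residue_dim (V : lmodType A) (I J : finType) (s : I -> V) (t : J -> V)
    (W : set V) : submod W -> (forall i a, m a -> W (a *: s i)) ->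
  (forall j, exists c : I -> A, W (t j - \sum_i c i *: s i)) ->
  (forall a : J -> A, W (\sum_j a j *: t j) -> forall j, m (a j)) ->
  (#|J| <= #|I|)%N /\ ((#|I| <= #|J|)%N ->
    forall b : I -> A, W (\sum_i b i *: s i) -> forall i, m (b i)).
Proof.
case: hk => pk_surj pk0 sW mW /choice[c cP] indep.
pose Cb := \matrix_(j < #|J|, i < #|I|) pk (c (enum_val j) (enum_val i)).
have key (v : 'rV[k]_#|J|) (b : I -> A) :
    (forall i, pk (b (enum_val i)) = (v *m Cb) 0 i) ->
    W (\sum_i b i *: s i) -> v = 0.
  move=> vb Wb; have /choice[a aP] j := pk_surj (v 0 (enum_rank j)).
  suff ma : forall j, m (a j).
    apply/rowP => j; rewrite mxE -[j]enum_valK -aP; exact/pk0.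
  apply: indep.
  have -> : \sum_j a j *: t j =
    (\sum_j a j *: (t j - \sum_i c j i *: s i) + \sum_i b i *: s i)
      - \sum_i (b i - \sum_j a j * c j i) *: s i.
    have -> : \sum_i (b i - \sum_j a j * c j i) *: s i =
        \sum_i b i *: s i - \sum_j a j *: (\sum_i c j i *: s i).
      under eq_bigr do rewrite scalerBl scaler_suml.
      rewrite sumrB; congr (_ - _); rewrite exchange_big; apply: eq_bigr => j _.
      by rewrite scaler_sumr; apply: eq_bigr => i _; rewrite scalerA.
    under [in RHS]eq_bigr do rewrite scalerBr.
    rewrite sumrB; module.
  apply: submodB => //; first apply: submodD => //.
    by apply: submod_sum => // j _; apply: submodZ.
  apply: submod_sum => // i _; apply: mW; apply/pk0.
  rewrite rmorphB rmorph_sum -[i]enum_rankK vb mxE (reindex (@enum_val J predT)) /=.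
    apply/subr0_eq; rewrite subr0; apply/eqP; rewrite subr_eq0; apply/eqP.
    by apply: eq_bigr => j _; rewrite rmorphM aP !mxE enum_valK.
  by exists enum_rank => j _; rewrite ?enum_rankK ?enum_valK.
have Cfree : row_free Cb.
  apply: inj_row_free => v vC; apply: (key v (fun=> 0)).
    by move=> i; rewrite vC mxE rmorph0.
  by rewrite big1 => [|i _]; [apply: submod0 | rewrite scale0r].
split=> [|IJ b Wb i].
  by rewrite -(eqP Cfree) rank_leq_col.
have Cfull : row_full Cb.
  by rewrite /row_full eqn_leq rank_leq_col (eqP Cfree).
pose bb : 'rV_#|I| := \row_i pk (b (enum_val i)).
have /submxP[v ev] : (bb <= Cb)%MS by apply: submx_full.
have v0 : v = 0 by apply: (key v b) => // l; rewrite -ev mxE.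
apply/pk0; have /rowP/(_ (enum_rank i)) := ev.
by rewrite v0 mul0mx !mxE enum_rankK.
Qed.

End ResidueField.

Section LinearCombination.
Variables (R : comNzRingType) (V : lmodType R) (n : nat) (g : 'I_n -> V).

Definition lincomb (v : 'rV[R]_n) : V := \sum_i v 0 i *: g i.

Fact lincomb_linear : linear lincomb.
Proof.
move=> a u v; rewrite /lincomb scaler_sumr -big_split; apply: eq_bigr => i _.
by rewrite !mxE scalerDl scalerA.
Qed.
HB.instance Definition _ := GRing.isLinear.Build R 'rV[R]_n V *:%R lincomb lincomb_linear.

Lemma lincombB : {morph lincomb : u v / u - v}. Proof. exact: linearB. Qed.
Lemma lincombZ a u : lincomb (a *: u) = a *: lincomb u. Proof. exact: linearZ. Qed.
Lemma lincomb_sum (J : finType) (F : J -> 'rV[R]_n) :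
  lincomb (\sum_j F j) = \sum_j lincomb (F j).
Proof. exact: linear_sum. Qed.

Lemma lincomb_span x : span (range g) x <-> exists v, lincomb v = x.
Proof.
split=> [/span_rangeP[c ->]|[v <-]]; last by apply/span_rangeP; eexists.
by exists (\row_i c i); apply: eq_bigr => i _; rewrite mxE.
Qed.

Lemma lincomb_ker_submod : submod [set v | lincomb v = 0].
Proof.
split=> /= [|u v hu hv|a v hv]; first exact: linear0.
- by rewrite linearD /= hu hv addr0.
- by rewrite linearZ /= hv scaler0.
Qed.

End LinearCombination.

Lemma row_span (R : comNzRingType) n (v : 'rV[R]_n) :
  v = \sum_i v 0 i *: (delta_mx 0 i : 'rV[R]_n).
Proof.
apply/rowP => j; rewrite summxE (bigD1 j) //= big1 => [|i /negbTE ij].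
  by rewrite !mxE !eqxx mulr1 addr0.
by rewrite !mxE eqxx eq_sym ij mulr0.
Qed.

Lemma row_submod_fg (R : comNzRingType) n (U : set 'rV[R]_n) :
  noetherian R -> submod U -> finitely_generated U.
Proof.
move=> noeR sU; apply: (noetherian_submod noeR (g := fun i => delta_mx 0 i)) => //.
by move=> v _; rewrite (row_span v); apply/span_rangeP; eexists.
Qed.

Lemma smul_lift (R : comNzRingType) (V W : lmodType R) (f : {linear V -> W})
    (I : set R) (U : set V) (U' : set W) :
  (forall y, U' y -> exists2 x, U x & f x = y) ->
  forall y, smul I U' y -> exists2 x, smul I U x & f x = y.
Proof.
move=> lift y; suff: smul I U' `<=` [set y | exists2 x, smul I U x & f x = y] by apply.
apply: smul_min; last first.
  by move=> a z Ia /lift[x Ux <-]; exists (a *: x); [apply: smulI | rewrite linearZ].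
split=> /= [|z t [x Ux <-] [x' Ux' <-]|a z [x Ux <-]].
- by exists 0; [apply: submod0 | rewrite linear0].
- by exists (x + x'); [apply: submodD | rewrite linearD].
- by exists (a *: x); [apply: submodZ | rewrite linearZ].
Qed.

Lemma smul_coef (R : comNzRingType) n (I : set R) (J : set R) (v : 'rV[R]_n) :
  ideal I -> ideal J ->
  @smul R _ I [set v : 'rV[R]_n | forall i, J (v 0 i)] v ->
  forall i, @smul R R^o I J (v 0 i).
Proof.
move=> iI iJ; suff : smul I [set v : 'rV[R]_n | forall i, J (v 0 i)] `<=`
   [set v : 'rV[R]_n | forall i, @smul R R^o I J (v 0 i)] by apply.
have sIJ := @smul_submod R R^o I J.
apply: smul_min; last by move=> a u Ia Ju i; rewrite mxE; apply: (@smulI R R^o).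
split=> /= [i|u w hu hw i|a u hu i]; rewrite mxE; first exact: submod0 sIJ.
- exact: (submodD sIJ).
- exact: (submodZ a sIJ).
Qed.

Section Counting.
Variables (A : comNzRingType) (m : set A) (k : fieldType) (pk : {rmorphism A -> k}).
Hypotheses (hk : is_quotient_by m pk) (im : ideal m).
Variables (X : lmodType A) (b0 b1 e : nat) (g : 'I_b0 -> X).
Local Notation K := [set v | lincomb g v = 0].
Local Notation mm U := (smul m (smul m U)).
Variables (kappa : 'I_b1 -> 'rV[A]_b0) (t : 'I_e -> A^o).
Variables (L : finType) (w : L -> X).
Hypothesis gX : span (range g) = setT.
Hypothesis g_indep : forall c : 'I_b0 -> A,
  smul m setT (\sum_i c i *: g i) -> forall i, m (c i).
Hypothesis kappaP : mod_basis m kappa K (smul m K).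
Hypothesis t_m : forall i, m (t i).
Hypothesis t_indep : forall c : 'I_e -> A,
  @smul A A^o m m (\sum_i c i *: t i) -> forall i, m (c i).
Hypothesis w_m : forall l, smul m setT (w l).
Hypothesis w_span : forall x, smul m setT x ->
  exists c : L -> A, mm setT (x - \sum_l c l *: w l).
Hypothesis card_le : (b1 + #|L| <= e * b0)%N.

Let row_m (v : 'rV[A]_b0) : (forall i, m (v 0 i)) -> smul m setT v.
Proof.
move=> mv; rewrite (row_span v); apply: submod_sum => // i _.
exact: smulI.
Qed.

Let Km : K `<=` smul m setT.
Proof.
move=> v Kv; apply: row_m; apply: g_indep.
by rewrite [X in smul _ _ X](_ : _ = lincomb g v) // Kv; apply: submod0.
Qed.

Let mKmm : smul m K `<=` mm setT. Proof. exact: smul_mono. Qed.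

Let lift_m x : smul m setT x -> exists2 v, smul m setT v & lincomb g v = x.
Proof.
apply: smul_lift => y _; have /lincomb_span[v <-] : span (range g) y by rewrite gX.
by exists v.
Qed.

(* The [kappa q] and lifts of the [w l] span m A^b0 modulo m^2 A^b0, which has
   dimension e * b0; by the cardinality assumption they form a basis. *)
Lemma count_equality : (e * b0)%N = (b1 + #|L|)%N /\
  (forall v, K v -> mm setT v -> smul m K v) /\
  (forall c : L -> A, mm setT (\sum_l c l *: w l) -> forall l, m (c l)).
Proof.
have /choice[la laP] l : exists v, smul m setT v /\ lincomb g v = w l.
  by have [v ? ?] := lift_m (w_m l); exists v.
pose s (i : 'I_b1 + L) := match i with inl q => kappa q | inr l => la l end.
pose tt (j : 'I_e * 'I_b0) : 'rV[A]_b0 := t j.1 *: delta_mx 0 j.2.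
have [kK ksp kin] := kappaP.
have sumS (c : 'I_b1 -> A) (d : L -> A) : exists b : 'I_b1 + L -> A,
    [/\ \sum_i b i *: s i = \sum_q c q *: kappa q + \sum_l d l *: la l,
        forall q, b (inl q) = c q & forall l, b (inr l) = d l].
  exists (fun i => match i with inl q => c q | inr l => d l end); split=> //.
  by rewrite big_sumType.
have smm : submod (mm [set: 'rV[A]_b0]) by [].
have [|||le ge] := @residue_dim A m k pk hk _ _ _ s tt (mm setT) smm.
- move=> [q|l] a ma; apply: smulI => //=; first exact: Km.
  exact: (laP l).1.
- move=> j; have xm : smul m setT (tt j) by apply: smulI => //; apply: t_m.
  (* [tt j] is corrected by lifts of the [w l] and by an element of m^2 A^b0 so as to fall into
     K. *)
  have [c cw] := w_span (linear_smul (f := lincomb g) (U := setT) (U' := setT) (fun _ _ => I) xm).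
  have [y my ey] := smul_lift lift_m cw.
  have Kx : K (tt j - \sum_l c l *: la l - y).
    rewrite /= !lincombB ey lincomb_sum.
    rewrite (eq_bigr (fun l => c l *: w l)) ?subrr // => l _.
    by rewrite lincombZ (laP l).2.
  have [d dP] := ksp _ Kx; have [b [eb _ _]] := sumS d c; exists b.
  have -> : tt j - \sum_i b i *: s i =
    (tt j - \sum_l c l *: la l - y - \sum_q d q *: kappa q) + y.
    by rewrite eb; module.
  by apply: submodD => //; apply: mKmm.
- move=> a hm [q i]; apply: (t_indep (c := fun q => a (q, i))).
  have sub v : smul m [set: 'rV[A]_b0] v -> [set v : 'rV[A]_b0 | forall i, m (v 0 i)] v.
    apply: smul_min; last first.
      by move=> c u mc _ l; rewrite mxE; apply: idealMr.
    split=> /= [l|u u' hu hu' l|c u hu l]; rewrite mxE; first by case: im.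
      exact: idealD.
    exact: idealM.
  have := smul_coef im im (smul_mono sub hm) i; congr (@smul A A^o m m _).
  have -> : (\sum_j a j *: tt j) 0 i = \sum_q \sum_l (a (q, l) *: tt (q, l)) 0 i.
    by rewrite summxE pair_bigA; apply: eq_bigr => -[].
  apply: eq_bigr => p _; rewrite (bigD1 i) //= big1 => [|l /negbTE li].
    by rewrite !mxE !eqxx mulr1 addr0.
  by rewrite !mxE eqxx eq_sym li !mulr0.
have ecard : (e * b0)%N = (b1 + #|L|)%N.
  apply/eqP; rewrite eqn_leq card_le andbT.
  by move: le; rewrite card_prod card_sum !card_ord.
have s_indep := ge _; rewrite card_prod card_sum !card_ord ecard leqnn in s_indep.
split=> //; split=> [v Kv mv|c wc l].
  have [d dP] := ksp _ Kv; have [b [eb bl _]] := sumS d (fun=> 0).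
  have md q : m (d q).
    rewrite -bl; apply: s_indep => //; rewrite eb [X in _ + X]big1 ?addr0.
      rewrite -[X in mm setT X](subKr v); apply: submodB => //; exact: mKmm.
    by move=> l _; rewrite scale0r.
  rewrite -(subrK (\sum_q d q *: kappa q) v); apply: submodD => //.
  by apply: submod_sum => // q _; apply: smulI.
have [y my ey] := smul_lift lift_m wc.
have Kx : K (\sum_l c l *: la l - y).
  rewrite /= lincombB ey lincomb_sum; apply/eqP; rewrite subr_eq0; apply/eqP.
  by apply: eq_bigr => j _; rewrite lincombZ (laP _).2.
have [d dP] := ksp _ Kx; have [b [eb _ <-]] := sumS (fun q => - d q) c.
apply: s_indep => //; rewrite eb.
have -> : \sum_q - d q *: kappa q + \sum_l c l *: la l =
   (\sum_l c l *: la l - y - \sum_q d q *: kappa q) + y.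
  by under eq_bigr do rewrite scaleNr; rewrite sumrN; module.
by apply: submodD => //; apply: mKmm.
Qed.

End Counting.

(** * The staircase argument *)

Lemma restr_scaleE (A B : comNzRingType) (phi : {rmorphism A -> B})
  (M : lmodType B) a (x : restr phi M) : a *: x = phi a *: (x : M) :> M.
Proof. by []. Qed.

Section FiniteMorphism.
Variables (A B : comNzRingType) (mA : set A) (mB : set B).
Variables (k : fieldType) (pk : {rmorphism A -> k}) (phi : {rmorphism A -> B}).
Hypotheses (mAL : local_units mA) (mBL : local_units mB) (noeB : noetherian B).
Hypothesis hk : is_quotient_by mA pk.
Local Notation J := (ideal_gen (phi @` mA)).

(* If B is spanned by n elements over A, then the chain mB ^ i + J cannot decrease
   strictly n + 1 times. *)
Lemma finite_fiber_nilpotent : finite_morphism phi ->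
  exists N, ideal_pow mB N `<=` J.
Proof.
move=> [n [b eb]]; have [imB mB1 mBU] := mBL; have [imA mA1 mAU] := mAL.
have iJ : ideal J := ideal_gen_ideal _.
have ip i := ideal_pow_ideal mB i.
have decr i j : (i <= j)%N -> ideal_pow mB j `<=` ideal_pow mB i.
  move=> /subnKC <-; elim: (j - i)%N => [|l IH]; first by rewrite addn0.
  by rewrite addnS; apply: subset_trans IH; apply: ideal_pow_decr.
have [i hi] : exists i, forall x, ideal_pow mB i x ->
    exists2 y, J y & ideal_pow mB i.+1 (x - y).
  apply: contrapT => /forallNP hN.
  have /choice[z zP] i : exists x, ideal_pow mB i x /\
      ~ exists2 y, J y & ideal_pow mB i.+1 (x - y).
    by have /existsNP[x /not_implyP[? ?]] := hN i; exists x.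
  have sJ : @submod A (restr phi B^o) J.
    split; [by case: iJ|by move=> x y; apply: idealD|].
    by move=> a x; apply: (@idealM B J (phi a) x iJ).
  have [|||le _] := @residue_dim A mA k pk hk (restr phi B^o) _ _ b
      (fun i : 'I_n.+1 => z i : restr phi B^o) J sJ.
  - move=> i a ma; apply: (@idealMr B J _ (phi a) iJ).
    by apply: mem_ideal_gen; exists a.
  - move=> i; have : span (range b) (z i : restr phi B^o) by rewrite -eb.
    by move=> /span_rangeP[c ->]; exists c; rewrite subrr; case: iJ.
  (* The coefficients of a relation are shown to lie in mA in increasing order of index: earlier
     terms are then in J and later ones in mB^(i+1), so a unit coefficient would contradict the
     choice of [z i]. These n + 1 independent elements are too many for n generators. *)
  - move=> a Ja [i]; elim/ltn_ind: i => i IH lti.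
    apply: contrapT => nma; have [v va] := mAU _ nma.
    have [_] := zP i; apply.
    pose S1 := \sum_(j < n.+1 | (j < i)%N) phi (a j) * z j.
    pose S2 := \sum_(j < n.+1 | (i < j)%N) phi (a j) * z j.
    have JS1 : J S1.
      apply: (@submod_sum B B^o) => // j ji; apply: idealMr => //.
      apply: mem_ideal_gen; exists (a j) => //; case: j ji => j ltj ji; exact: IH.
    have mS2 : ideal_pow mB i.+1 S2.
      apply: (@submod_sum B B^o); first exact: ip.
      move=> j ij; apply: (idealM _ (ip _)); apply: (decr i.+1 j ij); exact: (zP j).1.
    have eS : phi (a (Ordinal lti)) * z i + (S1 + S2) = \sum_(j < n.+1) phi (a j) * z j.
      rewrite (bigD1 (Ordinal lti)) //=; congr (_ + _).
      rewrite (bigID (fun j : 'I_n.+1 => (j < i)%N)) /=; congr (_ + _);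
        apply: eq_bigl => j; rewrite -(inj_eq val_inj) /=; case: ltngtP => //.
    exists (phi v * (\sum_(j < n.+1) phi (a j) * z j - S1)).
      by apply: (idealM _ iJ); apply: idealB.
    have -> : z i - phi v * (\sum_(j < n.+1) phi (a j) * z j - S1) = - phi v * S2.
      have {1}-> : z i = phi v * (phi (a (Ordinal lti)) * z i).
        by rewrite mulrA -rmorphM va rmorph1 mul1r.
      by rewrite -eS; ring.
    exact: (idealM _ (ip _)).
  by rewrite !card_ord ltnn in le.
exists i; apply: (@nakayama B mB mBL B^o _ J (noeB (ip i)) iJ) => x /hi[y Jy hy].
by exists y.
Qed.

(** Scalars from B can be moved onto the B-submodule U. This translates between the count over A and
    the relations over B. *)
Lemma smul_restr (M : lmodType B) (U : set M) : @submod B M U ->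
  @smul A (restr phi M) mA U = smul J U.
Proof.
move=> sU; have sJ := @smul_submod B M J U.
have sA : @submod B M (@smul A (restr phi M) mA U).
  have sAA := @smul_submod A (restr phi M) mA U.
  split; [exact: (submod0 sAA)|by move=> x y; apply: (submodD sAA)|].
  move=> b x; suff : @smul A (restr phi M) mA U `<=`
      [set x | @smul A (restr phi M) mA U (b *: (x : M))] by apply.
  apply: smul_min.
    split=> /= [|y z hy hz|a y hy].
    - by rewrite scaler0; apply: (submod0 sAA).
    - by rewrite scalerDr; apply: (submodD sAA).
    - have -> : b *: ((a *: y : restr phi M) : M) = (a *: (b *: (y : M) : restr phi M)).
        by rewrite !restr_scaleE !scalerA mulrC.
      exact: (submodZ _ sAA).
  move=> a y ma Uy /=.
  have -> : b *: ((a *: y : restr phi M) : M) = (a *: (b *: (y : M) : restr phi M)).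
    by rewrite !restr_scaleE !scalerA mulrC.
  by apply: (@smulI A (restr phi M)) => //; apply: (submodZ b sU).
apply/seteqP; split.
  apply: (@smul_min A (restr phi M)).
    split; [exact: (submod0 sJ)|by move=> x y; apply: (submodD sJ)|].
    by move=> a x; apply: (submodZ (phi a) sJ).
  by move=> a x ma Ux; apply: (@smulI B M J U (phi a)) => //; apply: mem_ideal_gen; exists a.
apply: (smul_min sA) => b x Jb Ux.
suff : J `<=` [set b | @smul A (restr phi M) mA U (b *: x)] by apply.
apply: (@span_min B B^o).
  split=> /= [|c d hc hd|c d hc].
  - by rewrite scale0r; apply: (submod0 sA).
  - by rewrite scalerDl; apply: (submodD sA).
  - by rewrite -scalerA; apply: (submodZ _ sA).
by move=> _ [a ma <-] /=; apply: (@smulI A (restr phi M) mA U a x).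
Qed.

End FiniteMorphism.

Section Staircase.
Variables (B C : comNzRingType) (mB J : set B) (pi : {rmorphism B -> C}).
Variables (f : nat) (x : 'cV[B]_f).
Hypotheses (mBL : local_units mB) (noeB : noetherian B) (iJ : ideal J).
Hypotheses (piJ : is_quotient_by J pi) (JmB : J `<=` mB).
Hypothesis mx : forall i, mB (x i 0).
Hypothesis xgen : forall b, mB b -> exists c : 'rV_f, b = (c *m x) 0 0.
Variable a : 'M[B]_f.
Hypothesis aP : ci_matrix (map_mx pi x) (map_mx pi a).

Let g i := (a *m x) i 0.
Let imB : ideal mB. Proof. by case: mBL. Qed.

Lemma ci_rel_mem i : J (g i).
Proof.
apply/piJ.2; case: aP => /matrixP/(_ i 0) + _ _.
by rewrite -map_mxM mxE /g => ->; rewrite mxE.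
Qed.

(** Write b = c x. Then c reduces to a syzygy modulo J, so it is a combination of rows of [a], plus
    a Koszul syzygy, which contributes 0, plus coefficients in J, which contribute an element of mB
    J. Nakayama's lemma concludes. *)
Lemma ci_rel_span b : J b -> exists c : 'I_f -> B, b = \sum_i c i * g i.
Proof.
suff h : J `<=` @Defs.span B B^o (range g) by move=> /h /(@span_rangeP B B^o)[c ->]; exists c.
have sJ : @submod B B^o J := iJ.
apply: (@nakayama B mB mBL B^o) => //; first exact: noeB.
move=> {}b Jb; have [c eb] := xgen (JmB Jb).
have [_ syz _] := aP; have [|u [h e]] := syz (map_mx pi c).
  apply/matrixP => i j; rewrite [i]ord1 [j]ord1 -map_mxM [RHS]mxE mxE -eb.
  exact/piJ.2.
have [pi_surj _] := piJ.
have /choice[u' u'P] i := pi_surj (u 0 i).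
have /choice[h' h'P] (ij : 'I_f * 'I_f) := pi_surj (h ij.1 ij.2).
pose H := \matrix_(i, j) h' (i, j); pose U := \row_i u' i.
exists ((U *m a *m x) 0 0).
  apply/(@span_rangeP B B^o); exists u'; rewrite -mulmxA mxE.
  by apply: eq_bigr => i _; rewrite [U _ _]mxE.
have HE : map_mx pi H = h by apply/matrixP => i j; rewrite !mxE h'P.
have UE : map_mx pi U = u by apply/matrixP => i j; rewrite [i]ord1 !mxE u'P.
pose c' := c - (U *m a + x^T *m (H - H^T)).
have Jc' i : J (c' 0 i).
  apply/piJ.2; suff /matrixP/(_ 0 i) : map_mx pi c' = 0 by rewrite !mxE.
  by rewrite map_mxB map_mxD !map_mxM map_mxB -!map_trmx HE UE e subrr.
have -> : b - (U *m a *m x) 0 0 = (c' *m x) 0 0.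
  have alt : x^T *m (H - H^T) *m x = 0.
    rewrite mulmxBr mulmxBl; apply/eqP; rewrite subr_eq0; apply/eqP.
    rewrite -[LHS]trmxK [(_ *m x)^T](_ : _ = x^T *m H^T *m x).
      by apply/matrixP => i j; rewrite [i]ord1 [j]ord1 mxE.
    by rewrite !trmx_mul trmxK mulmxA.
  by rewrite /c' mulmxBl mulmxDl alt addr0 eb [RHS]mxE [X in _ = _ + X]mxE.
rewrite mxE; apply: (@submod_sum B B^o) => // i _.
by rewrite mulrC; apply: (@smulI B B^o).
Qed.

(** Cramer's rule: det a times x is the adjugate of [a] times the relations. *)
Lemma ci_det_mul b : mB b -> J (b * \det a).
Proof.
move=> /xgen[c ->].
have -> : (c *m x) 0 0 * \det a = (c *m \adj a *m (a *m x)) 0 0.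
  rewrite mulmxA -[c *m _ *m a]mulmxA mul_adj_mx mul_mx_scalar.
  by rewrite -scalemxAl [RHS]mxE mulrC.
rewrite mxE; apply: (@submod_sum B B^o) => // i _; apply: (idealM _ iJ).
exact: ci_rel_mem.
Qed.

Variable M : lmodType B.
Local Notation JM := (smul J [set: M]).
Local Notation E := (kos M f).
Hypothesis rel_inj : forall u : 'I_f -> M,
  smul J JM (\sum_i g i *: u i) -> forall i, JM (u i).

Lemma smul_rel v : JM v -> exists u : 'I_f -> M, v = \sum_i g i *: u i.
Proof.
suff : JM `<=` [set v | exists u : 'I_f -> M, v = \sum_i g i *: u i] by apply.
apply: smul_min.
  split=> /= [|y z [u ->] [w ->]|b y [u ->]].
  - by exists (fun=> 0); rewrite big1 // => i _; rewrite scaler0.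
  - by exists (fun i => u i + w i); rewrite -big_split; apply: eq_bigr => i _; rewrite scalerDr.
  - exists (fun i => b *: u i); rewrite scaler_sumr; apply: eq_bigr => i _.
    by rewrite !scalerA mulrC.
move=> b y /ci_rel_span[c ->] _; exists (fun i => c i *: y).
by rewrite scaler_suml; apply: eq_bigr => i _; rewrite scalerA mulrC.
Qed.

Let y i := x i 0.
Let P (s : seq 'I_f) (w : E) : E := foldr (fun i => kwedge (fun j => a i j)) w s.

Let kd_P s v : exists h : 'I_f -> E,
  kd y (P s (kone f v)) = \sum_l g l *: h l /\ forall l, l \notin s -> h l = 0.
Proof.
elim: s => [|i s [h [eh h0]]].
  exists (fun=> 0); split=> //; rewrite kd_kone big1 // => l _; exact: scaler0.
exists (fun l => (l == i)%:R *: P s (kone f v) - kwedge (fun j => a i j) (h l)); split.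
  have -> : kd y (P (i :: s) (kone f v)) =
     g i *: P s (kone f v) - kwedge (fun j => a i j) (kd y (P s (kone f v))).
    by rewrite /= kd_kwedge /g mxE.
  rewrite eh linear_sum /=; under [in RHS]eq_bigr do rewrite scalerBr.
  rewrite sumrB; congr (_ - _).
    rewrite (bigD1 i) //= eqxx scale1r big1 ?addr0 // => l /negbTE ->.
    by rewrite scale0r scaler0.
  by apply: eq_bigr => l _; rewrite kwedgeZ.
move=> l; rewrite in_cons negb_or => /andP[/negbTE-> /h0->].
by rewrite linear0 scale0r subr0.
Qed.

(** The element [t] has coefficients in JM, so it is sum_l g_l h_l. Computing its boundary in two
    ways gives sum_l g_l F_l = 0, and [rel_inj] puts every F_l in JM. For l = i the correction [h']
    vanishes, since i is not in s, and F_i is the product over s minus a boundary. *)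
Let step i s mu w : i \notin s -> kin JM (P (i :: s) (kone f mu) - kd y w) ->
  exists w', kin JM (P s (kone f mu) - kd y w').
Proof.
move=> nis Iw; set t := _ - _ in Iw.
have s0 : @submod B M [set 0].
  by split=> // [_ _ -> ->|b _ ->] /=; rewrite ?addr0 ?scaler0.
have [|h [_ /kin0 /subr0_eq eh]] := @kin_split B M _ g [set 0] JM f 0 t s0 _ (kge0 _) Iw.
  by move=> v /smul_rel[u ->]; exists u; rewrite /= subrr.
have [h' [eh' h'0]] := kd_P s mu.
exists (h i).
pose F l : E := (l == i)%:R *: P s (kone f mu) - kwedge (fun j => a i j) (h' l) - kd y (h l).
have -> : P s (kone f mu) - kd y (h i) = F i.
  by rewrite /F eqxx h'0 // linear0 scale1r subr0.
apply: (@kin_inj B M _ g (smul J JM) JM f F rel_inj).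
suff -> : \sum_l g l *: F l = 0 by apply: submod0; apply: kin_submod.
have ekd : kd y t = \sum_l g l *: kd y (h l).
  by rewrite eh linear_sum; apply: eq_bigr => l _; rewrite /= kdZ.
have ekd' : kd y t = g i *: P s (kone f mu)
    - \sum_l g l *: kwedge (fun j => a i j) (h' l).
  rewrite /t linearB /= kd_kd subr0 kd_kwedge eh' linear_sum /g mxE.
  by congr (_ - _); apply: eq_bigr => l _; rewrite /= kwedgeZ.
under eq_bigr do rewrite !scalerBr; rewrite !sumrB -ekd ekd'.
rewrite (bigD1 i) //= eqxx scale1r big1 ?addr0 ?subrr // => l /negbTE ->.
by rewrite scale0r scaler0.
Qed.

(* By descending induction on the size of s: the exterior product of the rows of
   [a] indexed by s, times mu, is a boundary modulo J. *)
Lemma ci_staircase mu : JM (\det a *: mu) -> smul mB setT mu.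
Proof.
move=> Jmu.
have [w Iw] : exists w, kin JM (P (enum 'I_f) (kone f mu) - kd y w).
  exists 0; rewrite linear0 subr0.
  by rewrite [P _ _](kprod_det a mu); apply: kin_ktop.
have : exists w, kin JM (P [::] (kone f mu) - kd y w).
  elim: (enum 'I_f) (enum_uniq 'I_f) w Iw => [_ w Iw|i s IH /= /andP[nis us] w]; first by exists w.
  by move/(step nis) => [w' Iw']; apply: IH Iw'.
move=> [w' /kin_kbot]; rewrite linearB /= kbot_kone => Jm.
have sm : submod (smul mB [set: M]) by [].
rewrite -(subrK (kbot (kd y w')) mu); apply: submodD => //.
  suff /(_ _ Jm) : JM `<=` smul mB setT by [].
  by apply: smul_min => // b v /JmB mb _; apply: smulI.
by apply: kbot_kd => // i v; apply: smulI => //; apply: mx.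
Qed.

(* Otherwise some multiple of b lies in the socle of (B / J)^r, hence is a multiple
   of det a, which [ci_staircase] excludes. *)
Lemma ci_free_mod N r (u : 'I_r -> M) : ideal_pow mB N `<=` J ->
  (forall c : 'I_r -> B, smul mB setT (\sum_i c i *: u i) -> forall i, mB (c i)) ->
  forall b : 'I_r -> B, JM (\sum_i b i *: u i) -> forall i, J (b i).
Proof.
move=> mN u_indep b Jb; apply: contrapT => /existsNP[i0 nJb].
pose Q n := `[< forall c, ideal_pow mB n c -> forall i, J (c * b i) >].
have exQ : exists n, Q n.
  by exists N; apply/asboolP => c /mN Jc i; apply: idealMr.
case: (ex_minnP exQ) => -[|n] /asboolP Qn nmin.
  by apply: nJb; rewrite -[b i0]mul1r; apply: Qn.
have [c [mc [i nJc]]] : exists c, ideal_pow mB n c /\ exists i, ~ J (c * b i).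
  apply: contrapT => h; suff: (n.+1 <= n)%N by rewrite ltnn.
  apply: nmin; apply/asboolP => c mc i; apply: contrapT => nJ.
  by apply: h; exists c; split=> //; exists i.
have [pi_surj pi0] := piJ; have [_ _ soc] := aP.
have /choice[v vP] j : exists v, J (c * b j - v * \det a).
  have [|v ev] := soc (pi (c * b j)).
    move=> l; rewrite mxE -rmorphM; apply/pi0; rewrite mulrA; apply: Qn.
    by apply: ideal_powS.
  have [v' ev'] := pi_surj v; exists v'; apply/pi0.
  by rewrite rmorphB ev [in X in _ - X]rmorphM ev' det_map_mx subrr.
(* By the staircase sum_j v_j u_j lies in mB M, so each [v j] lies in mB and kills [\det a] modulo
   J, against the choice of c. *)
have mv : forall j, mB (v j).
  apply: u_indep; apply: ci_staircase.
  have -> : \det a *: (\sum_j v j *: u j) =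
     c *: (\sum_j b j *: u j) - \sum_j (c * b j - v j * \det a) *: u j.
    rewrite !scaler_sumr -sumrB; apply: eq_bigr => j _; module.
  apply: submodB => //; first exact: submodZ.
  by apply: submod_sum => // j _; apply: smulI.
by apply: nJc; apply: (ideal_subK iJ _ (vP i)); apply: ci_det_mul.
Qed.

End Staircase.

(** * Tor with the residue field *)

Section QuotientModule.
Variables (R : comNzRingType) (V : lmodType R) (U : set V) (sU : submod U).

Definition eqmod (x y : V) : bool := `[< U (x - y) >].

Fact eqmod_refl : reflexive eqmod.
Proof. by move=> x; apply/asboolP; rewrite subrr; apply: submod0. Qed.
Fact eqmod_sym : symmetric eqmod.
Proof.
by move=> x y; apply/asboolP/asboolP => h; rewrite -opprB; apply: submodN.
Qed.
Fact eqmod_trans : transitive eqmod.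
Proof.
move=> y x z /asboolP h /asboolP h'; apply/asboolP.
by rewrite -(subrK y x) -addrA; apply: submodD.
Qed.
Canonical eqmod_equiv := EquivRel eqmod eqmod_refl eqmod_sym eqmod_trans.

(** Tensor products are given only by their universal property; quotients supply the modules on
    which to test it. *)
Definition quotient_module : Type := {eq_quot eqmod_equiv}%qT.
Local Notation Q := quotient_module.
HB.instance Definition _ := Choice.on Q.
HB.instance Definition _ := EqQuotient.on Q.

Definition qproj (x : V) : Q := (\pi x)%qT.

Lemma qproj_eq x y : qproj x = qproj y <-> U (x - y).
Proof. by split=> [/eqmodP/asboolP|h] //; apply/eqmodP/asboolP. Qed.

Lemma qprojW (P : Q -> Prop) : (forall x, P (qproj x)) -> forall q, P q.
Proof. by move=> h; apply: quotW. Qed.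

Let rep (q : Q) : V := repr q.
Let repK x : U (rep (qproj x) - x).
Proof. by apply/qproj_eq; apply: reprK. Qed.

Let zero : Q := qproj 0.
Let opp (q : Q) : Q := qproj (- rep q).
Let add (p q : Q) : Q := qproj (rep p + rep q).
Let scale (a : R) (q : Q) : Q := qproj (a *: rep q).

Let addE x y : add (qproj x) (qproj y) = qproj (x + y).
Proof.
by apply/qproj_eq; rewrite opprD addrACA; apply: submodD.
Qed.
Let oppE x : opp (qproj x) = qproj (- x).
Proof. by apply/qproj_eq; rewrite -opprD; apply: submodN. Qed.
Let scaleE a x : scale a (qproj x) = qproj (a *: x).
Proof. by apply/qproj_eq; rewrite -scalerBr; apply: submodZ. Qed.

Fact quotient_addA : associative add.
Proof.
elim/qprojW => x; elim/qprojW => y; elim/qprojW => z; by rewrite !addE addrA.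
Qed.
Fact quotient_addC : commutative add.
Proof. elim/qprojW => x; elim/qprojW => y; by rewrite !addE addrC. Qed.
Fact quotient_add0 : left_id zero add.
Proof. by elim/qprojW => x; rewrite addE add0r. Qed.
Fact quotient_addN : left_inverse zero opp add.
Proof. by elim/qprojW => x; rewrite oppE addE addNr. Qed.
HB.instance Definition _ := GRing.isZmodule.Build Q
  quotient_addA quotient_addC quotient_add0 quotient_addN.

Fact quotient_scaleA a b q : scale a (scale b q) = scale (a * b) q.
Proof. by elim/qprojW: q => x; rewrite !scaleE scalerA. Qed.
Fact quotient_scale1 : left_id 1 scale.
Proof. by elim/qprojW => x; rewrite scaleE scale1r. Qed.
Fact quotient_scaleDr : right_distributive scale +%R.
Proof.
move=> a; elim/qprojW => x; elim/qprojW => y.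
have addQ u v : qproj u + qproj v = qproj (u + v) := addE u v.
by rewrite addQ !scaleE scalerDr -addQ.
Qed.
Fact quotient_scaleDl q : {morph scale^~ q : a b / a + b}.
Proof. by move=> a b; elim/qprojW: q => x; rewrite !scaleE scalerDl -addE. Qed.
HB.instance Definition _ := GRing.Zmodule_isLmodule.Build R Q
  quotient_scaleA quotient_scale1 quotient_scaleDr quotient_scaleDl.

Fact qproj_linear : linear qproj.
Proof. by move=> a x y; rewrite -addE -scaleE. Qed.
HB.instance Definition _ := GRing.isLinear.Build R V Q *:%R qproj qproj_linear.

Lemma qproj0 x : qproj x = 0 <-> U x.
Proof. by rewrite qproj_eq subr0. Qed.

End QuotientModule.

Section ResidueTensor.
Variables (A : comNzRingType) (m : set A) (k : fieldType) (pk : {rmorphism A -> k}).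
Hypotheses (hk : is_quotient_by m pk) (im : ideal m).
Local Notation N := (restr pk k^o).

Lemma bilinear_exists (P L : lmodType A) (f : P -> N -> L) :
  (forall c, linear (fun x => f x c)) -> (forall x, linear (f x)) ->
  exists g : {bilinear P -> N -> L}, forall x c, g x c = f x c.
Proof.
move=> fl fr.
pose b := bilinear_isBilinear.Build A P N L *:%R *:%R f (fl, fr).
pose g : {bilinear P -> N -> L} := HB.pack f b.
by exists g.
Qed.

(** For surjectivity, the projection of T modulo the image and the zero map both extend the zero
    bilinear map, so they agree. For the kernel, sending (x, c) to the class of a lift of c times x
    is bilinear into P / m P and factors through T. *)
Lemma residue_tensor (P T : lmodType A) (t : {bilinear P -> N -> T}) :
  is_tensor t ->
  (forall q, exists x, t x 1 = q) /\ (forall x, t x 1 = 0 <-> smul m setT x).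
Proof.
case: hk => pk_surj pk0 tensor.
have tA x a : t x (pk a : N) = t (a *: x) 1.
  have -> : (pk a : N) = a *: (1 : N) by rewrite restr_scaleE [RHS]mulr1.
  by rewrite linearZr_LR linearZl_LR.
have [lf lfK] := choice pk_surj.
split.
  pose U := [set q | exists x, t x 1 = q].
  have sU : submod U.
    split=> /= [|_ _ [x <-] [y <-]|a _ [x <-]].
    - by exists 0; rewrite linear0l.
    - by exists (x + y); rewrite linearDl.
    - by exists (a *: x); rewrite linearZl_LR.
  have [||z' z'E] := @bilinear_exists P (quotient_module sU) (fun _ _ => 0).
  - by move=> c a x y; rewrite scaler0 addr0.
  - by move=> x a c d; rewrite scaler0 addr0.
  have [g [_ guniq]] := tensor _ z'.
  move=> q; suff : U q by [].
  apply/(qproj0 sU).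
  have e1 : qproj sU =1 g.
    apply: (guniq (qproj sU : {linear T -> quotient_module sU})) => x c.
    by rewrite z'E /=; apply/qproj0; exists (lf c *: x); rewrite -tA lfK.
  have e2 : (\0 : T -> quotient_module sU) =1 g.
    by apply: (guniq (\0 : {linear T -> quotient_module sU})) => x c; rewrite z'E.
  by rewrite e1 -e2.
move=> x; split=> [tx0|]; last first.
  suff : smul m setT `<=` [set x | t x 1 = 0] by apply.
  apply: smul_min; last first.
    by move=> a y ma _ /=; rewrite -tA (pk0 a).2 // linear0r.
  split=> /= [|y z hy hz|a y hy]; first exact: linear0l.
  - by rewrite linearDl hy hz addr0.
  - by rewrite linearZl_LR hy scaler0.
have sm : submod (smul m [set: P]) by [].
have lf_m a b : pk a = pk b -> m (a - b) by move=> e; apply/pk0; rewrite rmorphB e subrr.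
have [||f fE] := @bilinear_exists P (quotient_module sm) (fun x c => qproj sm (lf c *: x)).
- by move=> c a y z /=; rewrite scalerDr !scalerA mulrC -scalerA linearP.
- move=> y a c d /=; rewrite -linearP; apply/qproj_eq.
  rewrite scalerA -scalerDl -scalerBl; apply: smulI => //; apply: lf_m.
  by rewrite rmorphD rmorphM !lfK.
have [g [gE _]] := tensor _ f.
have /qproj0 : qproj sm (lf 1 *: x) = 0 by rewrite -fE -gE tx0 linear0.
rewrite -[X in _ -> smul _ _ X]scale1r -[1 in X in _ -> X](subKr (lf 1)) scalerBl => h.
apply: submodB => //; apply: smulI => //; apply: lf_m.
by rewrite lfK rmorph1.
Qed.

(** [dim_over] picks some d with T isomorphic to k^d, so besides an isomorphism with k^n the
    uniqueness of d is needed; two bases are compared in both directions. *)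
Lemma dim_over_basis (T : lmodType A) n (t : 'I_n -> T) :
  (forall x, exists c : 'I_n -> A, x = \sum_i c i *: t i) ->
  (forall c : 'I_n -> A, \sum_i c i *: t i = 0 <-> forall i, m (c i)) ->
  dim_over pk T = n.
Proof.
move=> sp indep; case: hk => pk_surj pk0; have [co coE] := choice sp.
have [lf lfK] := choice pk_surj.
pose h (x : T) : restr pk 'rV[k]_n := \row_i pk (co x i).
have hE (c : 'I_n -> A) : h (\sum_i c i *: t i) = \row_i pk (c i).
  apply/rowP => i; rewrite !mxE; apply/subr0_eq; rewrite -rmorphB; apply/pk0.
  move: i; apply/(indep (fun i => co _ i - c i)).
  under eq_bigr do rewrite scalerBl.
  by rewrite sumrB -coE subrr.
have hlin : linear h.
  move=> a x y; rewrite (coE x) (coE y) scaler_sumr -big_split /=.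
  under eq_bigr do rewrite scalerA -scalerDl.
  rewrite !hE; apply/rowP => i; rewrite restr_scaleE !mxE.
  by rewrite rmorphD rmorphM.
pose hL := GRing.isLinear.Build A T (restr pk 'rV[k]_n) *:%R h hlin.
pose hh : {linear T -> restr pk 'rV[k]_n} := HB.pack h hL.
have hb : bijective h.
  exists (fun v : 'rV[k]_n => \sum_i lf (v 0 i) *: t i) => [x|v].
    rewrite [RHS]coE; apply/subr0_eq; rewrite -sumrB.
    under eq_bigr do rewrite -scalerBl.
    by apply/indep => i; apply/pk0; rewrite rmorphB lfK mxE subrr.
  by rewrite hE; apply/rowP => i; rewrite mxE lfK.
suff uniq d (g : {linear T -> restr pk 'rV[k]_d}) : bijective g -> d = n.
  have [g] := @xgetPex _ 0%N
    [set d | exists g : {linear T -> restr pk 'rV[k]_d}, bijective g]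
    (ex_intro _ n (ex_intro _ hh hb)).
  exact: uniq.
move=> [g' gK g'K].
pose t' (i : 'I_d) : T := g' (delta_mx 0 i).
have s0 : @submod A T [set 0].
  by split=> // [_ _ -> ->|b _ ->] /=; rewrite ?addr0 ?scaler0.
have g'sum (c : 'I_d -> A) : g (\sum_i c i *: t' i) = \row_i pk (c i).
  rewrite linear_sum [RHS]row_span; apply: eq_bigr => i _.
  by rewrite linearZ /= g'K mxE.
have gm a x : m a -> a *: (x : T) = 0.
  move=> ma; rewrite (coE x) scaler_sumr; under eq_bigr do rewrite scalerA.
  by apply/indep => i; apply: idealMr.
have g0 c : \sum_i c i *: t' i = 0 -> forall i, m (c i).
  move=> c0 i; apply/pk0; have := g'sum c; rewrite c0 linear0 => /rowP/(_ i).
  by rewrite !mxE.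
have le1 : (d <= n)%N.
  have [|||] := @residue_dim A m k pk hk T _ _ t t' [set 0] s0; rewrite ?card_ord //.
  - by move=> i a ma; apply: gm.
  - by move=> j; have [c ->] := sp (t' j); exists c; rewrite /= subrr.
have le2 : (n <= d)%N.
  have [|||] := @residue_dim A m k pk hk T _ _ t' t [set 0] s0; rewrite ?card_ord //.
  - by move=> i a ma; apply: gm.
  - move=> j; exists (fun i => lf ((g (t j) : 'rV_d) 0 i)) => /=.
    rewrite -[X in X - _ = _]gK -[X in _ - X]gK g'sum; apply/eqP; rewrite subr_eq0.
    by apply/eqP; congr g'; apply/rowP => i; rewrite mxE lfK.
  - by move=> c /indep.
by apply/eqP; rewrite eqn_leq le1 le2.
Qed.

End ResidueTensor.

Section TorDimension.
Variables (A : comNzRingType) (m : set A) (k : fieldType) (pk : {rmorphism A -> k}).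
Hypotheses (hk : is_quotient_by m pk) (im : ideal m).
Local Notation N := (restr pk k^o).

(** Here f identifies D / E with T; it is linear on D only, like the map from cycles to homology. *)
Lemma dim_over_subquotient (Y T : lmodType A) (D E : set Y) (f : Y -> T) n
    (u : 'I_n -> Y) : submod D ->
  (forall a x y, D x -> D y -> f (a *: x + y) = a *: f x + f y) ->
  (forall z, exists2 x, D x & f x = z) ->
  (forall x, D x -> f x = 0 <-> E x) ->
  smul m D `<=` E -> mod_basis m u D E -> dim_over pk T = n.
Proof.
move=> sD flin fsurj fE mDE [Du usp uind].
have f0 : f 0 = 0.
  have := flin (-1) 0 0 (submod0 sD) (submod0 sD).
  by rewrite scaler0 add0r scaleN1r addNr.
have fsum (c : 'I_n -> A) : f (\sum_i c i *: u i) = \sum_i c i *: f (u i).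
  pose R x z := D x /\ f x = z.
  suff : R (\sum_i c i *: u i) (\sum_i c i *: f (u i)) by case.
  apply: (big_rec2 R) => [|i x z _ [Dx <-]]; first by split=> //; apply: submod0.
  split; last by rewrite flin.
  by apply: submodD => //; apply: submodZ.
have Dsum (c : 'I_n -> A) : D (\sum_i c i *: u i).
  by apply: submod_sum => // i _; apply: submodZ.
apply: (dim_over_basis hk im (t := fun i => f (u i))) => [z|c].
  have [x Dx <-] := fsurj z; have [c Ec] := usp x Dx; exists c.
  rewrite -fsum; apply/subr0_eq; rewrite addrC -scaleN1r -flin //.
  by apply/fE; [apply: submodD => //; apply: submodZ | rewrite scaleN1r addrC].
rewrite -fsum fE //; split; first exact: uind.
move=> mc; apply: mDE; apply: submod_sum => // i _; exact: smulI.
Qed.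

Variables (X : lmodType A) (b0 b1 : nat) (g : 'I_b0 -> X).
Variable kappa : 'I_b1 -> 'rV[A]_b0.
Local Notation K := [set v | lincomb g v = 0].
Hypothesis gX : span (range g) = setT.
Hypothesis g_basis : mod_basis m g setT (smul m setT).
Hypothesis kappaP : mod_basis m kappa K (smul m K).

Lemma ker_lincomb_smul : K `<=` smul m setT.
Proof.
move=> v Kv; rewrite (row_span v); apply: submod_sum => // i _.
have [_ _ ind] := g_basis; apply: smulI => //; apply: ind.
by rewrite [X in smul _ _ X](_ : _ = lincomb g v) // Kv; apply: submod0.
Qed.

(** The cokernel of P_1 / m P_1 -> P_0 / m P_0 is X / m X, by exactness at P_0. *)
Lemma dim_Tor0 T : is_Tor 0 X N T -> dim_over pk T = b0.
Proof.
move=> [P [d [e [Q [t [dQ [[proj esurj ex0 exS] tens dt [h [hlin hsurj hker]]]]]]]]].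
have tE i := residue_tensor hk (tens i).
have /choice[p pE] i := esurj (g i).
have [_ gsp gind] := g_basis.
apply: (@dim_over_subquotient (P 0%N) T setT [set x | smul m setT (e x)]
  (fun x => h (t 0%N x 1)) b0 p) => //.
- by move=> a x y _ _; rewrite linearDl linearZl_LR hlin.
- by move=> z; have [q _ <-] := hsurj z; have [x <-] := (tE 0%N).1 q; exists x.
- move=> x _; rewrite hker //; split=> [[q]|/= mex].
    have [z <-] := (tE 1%N).1 q; rewrite dt => /eqP; rewrite -subr_eq0 -linearBl => /eqP.
    move=> /(tE 0%N).2 h0; have := linear_smul (U' := setT) (f := e) (fun _ _ => I) h0.
    rewrite linearB /= (_ : e (d 0%N z) = 0); last by apply/ex0; exists z.
    by rewrite sub0r => h1; rewrite -[e x]opprK; apply: submodN.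
  have [y my ey] : exists2 y, smul m setT y & e y = e x.
    by apply: smul_lift mex => y _; have [x' <-] := esurj y; exists x'.
  have [z ez] : exists z, d 0%N z = x - y by apply/ex0; rewrite linearB /= ey subrr.
  exists (t 1%N z 1); rewrite dt ez linearBl.
  by rewrite [X in _ - X]((tE 0%N).2 y).2 // subr0.
- by move=> x /(linear_smul (U' := setT) (f := e) (fun _ _ => I)).
- split=> // [x _|c /=].
    have [c cP] := gsp (e x) I; exists c; rewrite /= linearB linear_sum /=.
    by under eq_bigr do rewrite linearZ /= pE.
  rewrite linear_sum /= => hc; apply: gind; move: hc.
  by under eq_bigr do rewrite linearZ /= pE.
Qed.

(* With Om the kernel of P_0 -> X, Tor_1 is (Om inter m P_0) / m Om, which is
   compared with K / m K through lifts A^b0 -> P_0 and P_0 -> A^b0 of the identity. *)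
Lemma dim_Tor1 T : is_Tor 1 X N T -> dim_over pk T = b1.
Proof.
move=> [P [d [e [Q [t [dQ [[proj esurj ex0 exS] tens dt [h [hlin hsurj hker]]]]]]]]].
have tE i := residue_tensor hk (tens i).
have /choice[p pE] i := esurj (g i).
have [_ gsp gind] := g_basis; have [kK ksp kind] := kappaP.
pose alpha := lincomb p.
have ealpha v : e (alpha v) = lincomb g v.
  rewrite /alpha /lincomb linear_sum; apply: eq_bigr => i _.
  by rewrite linearZ /= pE.
(* The composites of [alpha] and [beta] differ from the identity by maps into [Om] and K; on m P_0
   and m A^b0 the difference therefore falls into m Om and m K. *)
have [|beta betaE] := proj 0%N _ _ (lincomb g : {linear 'rV[A]_b0 -> X}) e.
  by move=> y; apply/lincomb_span; rewrite gX.
pose Om := [set y | e y = 0].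
have aK v : K v -> Om (alpha v) by rewrite /Om /= ealpha.
have bO y : Om y -> K (beta y) by rewrite /Om /= => ey; rewrite betaE.
have KO : smul m K `<=` smul m setT by apply: smul_mono.
have ab y : smul m setT y -> smul m Om (y - alpha (beta y)).
  apply: (linear_smul (f := (idfun \- (alpha \o beta) : {linear P 0%N -> P 0%N}))).
  by move=> z _; rewrite /Om /= linearB /= ealpha betaE subrr.
have ba v : smul m setT v -> smul m K (v - beta (alpha v)).
  apply: (linear_smul (f := (idfun \- (beta \o alpha) : {linear 'rV[A]_b0 -> 'rV[A]_b0}))).
  by move=> z _; rewrite /= linearB /= betaE ealpha subrr.
have /choice[xi xiE] i : exists x, d 0%N x = alpha (kappa i).
  by apply/ex0; apply: aK; apply: kK.
have dxi (c : 'I_b1 -> A) : d 0%N (\sum_i c i *: xi i) = alpha (\sum_i c i *: kappa i).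
  rewrite linear_sum /alpha lincomb_sum; apply: eq_bigr => i _.
  by rewrite linearZ /= xiE lincombZ.
have ddO x : Om (d 0%N x) by apply/ex0; exists x.
have sOm : submod (smul m Om) by [].
have sK : submod (smul m K) by [].
(* Elements of P_1 whose class in P_1 / m P_1 is a cycle. *)
pose D := [set x | smul m setT (d 0%N x)].
have cyc x : D x -> cycles dQ (t 1%N x 1 : Q 1%N).
  by move=> Dx; rewrite /cycles /= dt; apply/(tE 0%N).2.
apply: (@dim_over_subquotient (P 1%N) T D [set x | smul m Om (d 0%N x)]
  (fun x => h (t 1%N x 1)) b1 xi).
- split=> [|x y|a x]; rewrite /D /=.
  + by rewrite linear0; apply: submod0.
  + by rewrite linearD; apply: submodD.
  + by rewrite linearZ; apply: submodZ.
- by move=> a x y Dx Dy; rewrite linearDl linearZl_LR hlin //; apply: cyc.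
- move=> z; have [q cq <-] := hsurj z; have [x ex] := (tE 1%N).1 q.
  exists x; rewrite ?ex //; move: cq; rewrite -ex /cycles /= dt.
  by move/(tE 0%N).2.
- move=> x Dx; rewrite hker; last exact: cyc.
  split=> [[q]|/= mdx].
    have [z <-] := (tE 2%N).1 q; rewrite dt => /eqP; rewrite -subr_eq0 -linearBl => /eqP.
    move=> /(tE 1%N).2 h0; have := linear_smul (U' := Om) (f := d 0%N) (fun x _ => ddO x) h0.
    rewrite linearB /= (_ : d 0%N (d 1%N z) = 0); last by apply/(exS 0%N); exists z.
    by rewrite sub0r => h1; rewrite -[X in smul m Om X]opprK; apply: submodN.
  have [y my ey] : exists2 y, smul m setT y & d 0%N y = d 0%N x.
    by apply: smul_lift mdx => y /ex0[x' <-]; exists x'.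
  have [z ez] : exists z, d 1%N z = x - y by apply/(exS 0%N); rewrite linearB /= ey subrr.
  exists (t 2%N z 1); rewrite dt ez linearBl.
  by rewrite [X in _ - X]((tE 1%N).2 y).2 // subr0.
- move=> x mx; apply: linear_smul mx => y _; exact: ddO.
- split=> [i|x Dx|c /=]; rewrite /D /=.
  + rewrite xiE; apply: (linear_smul (f := lincomb p) (U := setT)) => //.
    by apply: ker_lincomb_smul; apply: kK.
  + have [c cP] := ksp (beta (d 0%N x)) (bO _ (ddO x)); exists c.
    rewrite linearB /= dxi.
    have -> : d 0%N x - alpha (\sum_i c i *: kappa i) =
       (d 0%N x - alpha (beta (d 0%N x))) + alpha (beta (d 0%N x) - \sum_i c i *: kappa i).
      by rewrite /alpha lincombB; module.
    apply: submodD => //; first exact: ab.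
    exact: (linear_smul (f := lincomb p) aK).
  + rewrite dxi; set w := \sum_i c i *: kappa i => hw; apply: kind; rewrite -/w.
    have Kw : K w.
      apply: submod_sum; first exact: lincomb_ker_submod.
      by move=> i _; apply: submodZ; [exact: lincomb_ker_submod | apply: kK].
    rewrite -(subrK (beta (alpha w)) w); apply: submodD => //.
      by apply: ba; apply: ker_lincomb_smul.
    exact: (linear_smul bO hw).
Qed.

End TorDimension.

(** * Freeness *)

Lemma ideal_pow_map (R R' : comNzRingType) (h : {rmorphism R -> R'}) (I : set R)
    (I' : set R') n x :
  (forall a, I a -> I' (h a)) -> ideal_pow I n x -> ideal_pow I' n (h x).
Proof.
move=> hI; elim: n x => // n IH x.
have ip := ideal_pow_ideal I' n.+1.
suff : ideal_pow I n.+1 `<=` [set x | ideal_pow I' n.+1 (h x)] by apply.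
apply: (@smul_min R R^o).
  split=> /= [|y z hy hz|a y hy].
  - by rewrite rmorph0; case: ip.
  - by rewrite rmorphD; apply: idealD.
  - by rewrite rmorphM; apply: idealM.
by move=> a y /hI Ia /IH Iy /=; rewrite rmorphM; apply: ideal_powS.
Qed.

Lemma ideal_pow_lift (R R' : comNzRingType) (h : {rmorphism R -> R'}) (I : set R)
    (I' : set R') n y :
  (forall z, exists x, h x = z) -> (forall b, I' b -> exists2 a, I a & h a = b) ->
  ideal_pow I' n y -> exists2 x, ideal_pow I n x & h x = y.
Proof.
move=> surj lift; elim: n y => [|n IH] y; first by have [x <-] := surj y; exists x.
have ip := ideal_pow_ideal I n.+1.
suff : ideal_pow I' n.+1 `<=` [set y | exists2 x, ideal_pow I n.+1 x & h x = y] by apply.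
apply: (@smul_min R' R'^o).
  split=> /= [|_ _ [x ? <-] [x' ? <-]|a _ [x ? <-]].
  - by exists 0; [case: ip | rewrite rmorph0].
  - by exists (x + x'); [apply: idealD | rewrite rmorphD].
  - by have [a' <-] := surj a; exists (a' * x); [apply: idealM | rewrite rmorphM].
move=> _ _ /lift[a Ia <-] /IH[x Ix <-]; exists (a * x); last by rewrite rmorphM.
exact: ideal_powS.
Qed.

(** The maximal ideal of F is nilpotent, so its completion C is again B / J and m_S^N lies in (s).
    The matrix found for generators of m_S is carried over to the images of x and lifted entrywise
    to B. *)
Lemma exists_ci_matrix (B F : comNzRingType) (mB J : set B) (pF : {rmorphism B -> F})
    N f (x : 'cV[B]_f) :
  local_units mB -> J `<=` mB -> ideal_pow mB N `<=` J ->
  is_quotient_by J pF -> complete_intersection F ->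
  (forall i, mB (x i 0)) -> (forall b, mB b -> exists c : 'rV_f, b = (c *m x) 0 0) ->
  exists (C : comNzRingType) (pi : {rmorphism B -> C}) (a : 'M[B]_f),
    is_quotient_by J pi /\ ci_matrix (map_mx pi x) (map_mx pi a).
Proof.
move=> [imB mB1 mBU] JmB mBN [pF_surj pF0] [mF [nlF]].
move=> [C [S [mS [s [q [compl regS regs qs]]]]]] mx xgen.
have [imF mF1 _] := noetherian_local_units nlF.
have mFN : ideal_pow mF N `<=` [set 0].
  move=> y /(ideal_pow_lift (I := mB) pF_surj)[z mFz|z /mBN Jz <-]; last exact/pF0.
  have [b eb] := pF_surj z; exists b => //; apply: contrapT => /mBU[b' b'b].
  by apply: mF1; rewrite -(rmorph1 pF) -b'b rmorphM eb; apply: idealM.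
have [psi [psi' psiK psi'K]] := completion_nilpotent mFN compl.
pose pi : {rmorphism B -> C} := psi \o pF.
have pi_surj c : exists b, pi b = c.
  by have [b eb] := pF_surj (psi' c); exists b; rewrite /= eb psi'K.
have pi0 b : pi b = 0 <-> J b.
  split=> [/= e|/pF0 /= ->]; last by rewrite rmorph0.
  by apply/pF0; rewrite -[LHS]psiK e -(rmorph0 psi) psiK.
have piJ : is_quotient_by J pi by [].
pose mC := [set c | exists2 b, mB b & pi b = c].
have mCP b : mC (pi b) -> mB b.
  move=> [b' mb' e]; apply: (ideal_subK imB mb'); apply: JmB.
  by apply/pi0; rewrite rmorphB e subrr.
have imC : ideal mC.
  split; first by exists 0; rewrite ?rmorph0 //; case: imB.
  - move=> _ _ [b mb <-] [c mc <-]; exists (b + c); first exact: idealD.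
    by rewrite rmorphD.
  - move=> c _ [b mb <-]; have [c' <-] := pi_surj c.
    by exists (c' * b); [apply: idealM | rewrite rmorphM].
have mCL : local_units mC.
  split=> //; first by rewrite -(rmorph1 pi) => /mCP.
  move=> c; have [b <-] := pi_surj c => nm.
  have [|b' e] := mBU b; first by move=> mb; apply: nm; exists b.
  by exists (pi b'); rewrite -rmorphM e rmorph1.
have [_ mC1 mCU] := mCL.
have [imS mS1 mSU] := noetherian_local_units regS.1.
have [q_surj q0] := qs.
have smS : ideal_gen [set` s] `<=` mS.
  move=> t st; apply: contrapT => /mSU[t' e]; apply: regs.1; rewrite -e.
  exact: (idealM _ (ideal_gen_ideal _)).
have mSC t : mS t -> mC (q t).
  move=> mt; apply: contrapT => /mCU[c]; have [t' <-] := q_surj c.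
  rewrite -rmorphM => e; apply: mS1; rewrite -[1](subKr (t' * t)).
  apply: idealB => //; first exact: idealM.
  by apply: smS; apply/q0; rewrite rmorphB e rmorph1 subrr.
have mCS c : mC c -> exists2 t, mS t & q t = c.
  have [t <-] := q_surj c => mt; exists t => //; apply: contrapT => /mSU[t' e].
  by apply: mC1; rewrite -(rmorph1 q) -e rmorphM; apply: idealM.
have mSN : ideal_pow mS N `<=` ideal_gen [set` s].
  move=> t /(ideal_pow_map mSC) /(ideal_pow_lift (I := mB) pi_surj)[//|b /mBN Jb e].
  by apply/q0; rewrite -e; apply/pi0.
have [d [y [ciy ymS ygen]]] := regular_quotient_ci regS regs qs mSN.
have [zC zP] : ci_gens (map_mx pi x).
  apply: (ci_gens_exchange mCL _ _ _ _ ciy).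
  - by move=> i; have [t mt ->] := ymS i; apply: mSC.
  - by move=> i; rewrite mxE; exists (x i 0).
  - by move=> c /mCS[t mt <-]; apply: ygen.
  - move=> _ [b /xgen[c ->] <-]; exists (map_mx pi c).
    by rewrite -map_mxM [RHS]mxE.
have /choice[l lP] (ij : 'I_f * 'I_f) := pi_surj (zC ij.1 ij.2).
exists C, pi, (\matrix_(i, j) l (i, j)); split=> //.
suff -> : map_mx pi (\matrix_(i, j) l (i, j)) = zC by [].
by apply/matrixP => i j; rewrite !mxE lP.
Qed.

Lemma span_basis_full (R : comNzRingType) (m : set R) (V : lmodType R) n
    (g : 'I_n -> V) : local_units m -> finitely_generated [set: V] ->
  mod_basis m g setT (smul m setT) -> span (range g) = setT.
Proof.
move=> mL fV [_ gsp _]; apply/seteqP; split=> //.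
apply: (nakayama mL fV) => // x /gsp[c hc]; exists (\sum_i c i *: g i) => //.
by apply/span_rangeP; exists c.
Qed.

Lemma fg_mod_basis (R : comNzRingType) (m : set R) (V : lmodType R) (U : set V) :
  local_units m -> finitely_generated U -> submod U ->
  exists n (g : 'I_n -> V), mod_basis m g U (smul m U).
Proof.
move=> mL [n [g eU]] sU; apply: (exists_mod_basis mL (u := g)) => //; split.
  by move=> i; rewrite eU; apply: mem_span_range.
move=> x; rewrite {1}eU => /span_rangeP[c ->]; exists c; rewrite subrr.
exact: submod0.
Qed.

(** By Nakayama's lemma a family spanning m modulo m^2 generates m, so a minimal generating system
    is also minimal modulo m^2. *)
Lemma edim_basis (R : comNzRingType) (m : set R) : noetherian_local m ->
  exists t : 'I_(edim m) -> R^o, @mod_basis R m R^o _ t m (@smul R R^o m m).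
Proof.
move=> nlR; have mL := noetherian_local_units nlR; have [im _ _] := mL.
have fm := nlR.1 _ im; have [[t et] tmin] := min_generatorsP fm.
exists t; apply: (minimal_mod_basis mL) => //.
  split=> [i|x]; first by rewrite [X in X _]et; apply: mem_span_range.
  rewrite {1}et => /span_rangeP[c ->]; exists c; rewrite subrr.
  by apply: submod0; apply: (@smul_submod R R^o).
move=> p v [vm vsp]; apply: tmin; exists v; apply/seteqP; split; last first.
  exact: (@span_range_sub R R^o).
apply: (@nakayama R m mL R^o) => // x /vsp[c hc]; exists (\sum_i c i *: v i) => //.
by apply/span_rangeP; exists c.
Qed.

Section Freeness.
Variables (A B : comNzRingType) (mA : set A) (mB : set B) (phi : {rmorphism A -> B}).
Hypotheses (mAL : local_units mA) (mBL : local_units mB) (noeB : noetherian B).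
Hypotheses (phi_finite : finite_morphism phi) (phi_local : local_morphism mA mB phi).
Local Notation J := (ideal_gen (phi @` mA)).
Variables (M : lmodType B) (b0 f r : nat).
Variables (g : 'I_b0 -> restr phi M) (u : 'I_r -> M) (rel : 'I_f -> B).
Local Notation K := [set v | lincomb g v = 0].
Local Notation L := [set v | lincomb u v = 0].
Hypothesis uM : span (range u) = setT.
Hypothesis g_span : forall x : restr phi M, exists c : 'I_b0 -> A,
  x = \sum_i c i *: g i.
Hypothesis K_small : forall v, K v ->
  smul mA (smul mA [set: 'rV[A]_b0]) v -> smul mA K v.
Hypothesis rel_span : forall b, J b -> exists c : 'I_f -> B, b = \sum_l c l * rel l.
Hypothesis relJ : forall l, J (rel l).
Hypothesis rel_inj : forall w : 'I_f -> M,
  smul J (smul J setT) (\sum_l rel l *: w l) -> forall l, smul J setT (w l).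
Hypothesis u_indep : forall b : 'I_r -> B,
  smul J setT (\sum_i b i *: u i) -> forall i, J (b i).

Let Y : lmodType A := restr phi 'rV[B]_r.

Lemma restr_row_fg : finitely_generated [set: Y].
Proof.
have [n [b eb]] := phi_finite.
pose w (p : 'I_n * 'I_r) : Y := (b p.1 : B) *: (delta_mx 0 p.2 : 'rV[B]_r).
suff -> : [set: Y] = span (range w) by apply: fg_range.
apply/seteqP; split=> // v _; rewrite (row_span (v : 'rV[B]_r)).
apply: (@submod_sum A Y) => // i _.
have : span (range b) ((v : 'rV[B]_r) 0 i : restr phi B^o) by rewrite -eb.
move=> /span_rangeP[c ->]; apply/span_rangeP.
exists (fun p => if p.2 == i then c p.1 else 0).
rewrite -(pair_bigA _ (fun q j => (if j == i then c q else 0) *: w (q, j))) /=.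
rewrite scaler_suml; apply: eq_bigr => q _.
rewrite (bigD1 i) //= eqxx big1 ?addr0 => [|j /negbTE ->]; last by rewrite scale0r.
by rewrite !restr_scaleE /w /= scalerA.
Qed.

(** The coordinates of v are in J by [u_indep]. Expanding them in the relations and applying
    [rel_inj], then [u_indep] again, puts the new coefficients in J too. *)
Lemma ker_in_square v : L v -> smul J (smul J [set: 'rV[B]_r]) v.
Proof.
move=> Lv; have Jv i : J (v 0 i).
  apply: u_indep; rewrite [X in smul _ _ X](_ : _ = lincomb u v) // Lv.
  exact: submod0.
have /choice[c cP] i := rel_span (Jv i).
have Jc l i : J (c i l).
  move: i; apply: u_indep; apply: (rel_inj (w := fun l => \sum_i c i l *: u i)).
  suff -> : \sum_l rel l *: (\sum_i c i l *: u i) = lincomb u v.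
    by rewrite Lv; apply: submod0.
  under eq_bigr do rewrite scaler_sumr.
  rewrite exchange_big; apply: eq_bigr => i _; rewrite cP scaler_suml.
  by apply: eq_bigr => p _; rewrite scalerA mulrC.
have -> : v = \sum_l rel l *: (\row_i c i l).
  apply/rowP => i; rewrite cP summxE; apply: eq_bigr => l _.
  by rewrite !mxE mulrC.
apply: submod_sum => // l _; apply: smulI => //.
rewrite (row_span (\row_i c i l)); apply: submod_sum => // i _.
by apply: smulI => //; rewrite mxE.
Qed.

(** Lifting [g] to B^r gives a map A^b0 -> B^r over M, shown to be onto. An element of L, lying in
    J^2 B^r, comes from some w in mA^2 A^b0 that is in K; [K_small] puts w in mA K, so the element
    lies in mA L, hence in mB L. *)
Lemma ker_trivial v : L v -> v = 0.
Proof.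
have sL : submod L := lincomb_ker_submod u.
apply: (nakayama0 mBL (U := L)); first exact: row_submod_fg.
move=> {}v Lv.
have /choice[be beP] i : exists w, lincomb u w = (g i : M).
  by apply/lincomb_span; rewrite uM.
pose be' : 'I_b0 -> Y := be.
have ube w : lincomb u (lincomb be' w : 'rV[B]_r) = (lincomb g w : M).
  have -> : lincomb be' w = \sum_i phi (w 0 i) *: be i :> 'rV[B]_r by [].
  by rewrite lincomb_sum; apply: eq_bigr => i _; rewrite lincombZ beP.
(* The lifts generate B^r up to L, which lies in J B^r; Nakayama's lemma over A removes the
   error. *)
have span_be : span (range be') = [set: Y].
  apply/seteqP; split=> //.
  apply: (nakayama mAL restr_row_fg) => // w _.
  have [c ec] := g_span (lincomb u (w : 'rV[B]_r)).
  pose cc := \row_i c i.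
  exists (lincomb be' cc); first by apply/lincomb_span; exists cc.
  rewrite (@smul_restr A B mA phi 'rV[B]_r setT) //.
  set z : 'rV[B]_r := w - _.
  have Lz : lincomb u z = 0.
    rewrite /z (lincombB u) ube ec; apply/eqP; rewrite subr_eq0; apply/eqP.
    by apply: eq_bigr => i _; rewrite mxE.
  rewrite -/z (row_span z); apply: submod_sum => // i _; apply: smulI => //.
  apply: u_indep; rewrite [X in smul _ _ X](_ : _ = lincomb u z) // Lz.
  exact: submod0.
have Jv := ker_in_square Lv.
have mv : @smul A Y mA (@smul A Y mA setT) v.
  by rewrite (@smul_restr A B mA phi 'rV[B]_r) ?(@smul_restr A B mA phi 'rV[B]_r setT).
have [w mw ew] : exists2 w, smul mA (smul mA [set: 'rV[A]_b0]) w & lincomb be' w = v.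
  apply: (smul_lift _ mv) => y; apply: smul_lift => {}y _.
  have /lincomb_span[y' ey'] : span (range be') y by rewrite span_be.
  by exists y'.
have Kw : K w by rewrite /= -ube ew.
have : @smul A Y mA L (lincomb be' w).
  by apply: (linear_smul _ (K_small Kw mw)) => z; rewrite /= ube.
rewrite ew; suff : @smul A Y mA L `<=` smul mB L by apply.
apply: (@smul_min A Y); last by move=> a y ma Ly; apply: (@smulI B 'rV[B]_r) => //; apply: phi_local.
have sm := @smul_submod B 'rV[B]_r mB L.
split; [exact: (submod0 sm)|by move=> x y; apply: (submodD sm)|].
by move=> a x; apply: (submodZ (phi a) sm).
Qed.

Lemma free_of_ker_trivial : free_module M.
Proof.
exists 'I_r, u; split=> // n h h_inj c c0 j.
have : lincomb u (\sum_l c l *: delta_mx 0 (h l)) = 0.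
  rewrite lincomb_sum -[RHS]c0; apply: eq_bigr => l _; rewrite lincombZ.
  congr (_ *: _); rewrite /lincomb (bigD1 (h l)) //= big1 => [|i /negbTE il].
    by rewrite mxE !eqxx scale1r addr0.
  by rewrite mxE eqxx il scale0r.
move/ker_trivial => /rowP/(_ (h j)); rewrite summxE (bigD1 j) //= big1 => [|l lj].
  by rewrite !mxE !eqxx mulr1 addr0.
by rewrite !mxE eqxx (inj_eq h_inj) eq_sym (negbTE lj) mulr0.
Qed.

End Freeness.

Theorem theorem1p4
  (A B : comNzRingType) (mA : set A) (mB : set B)
  (hA : noetherian_local mA) (hB : noetherian_local mB)
  (phi : {rmorphism A -> B})
  (phi_finite : finite_morphism phi) (phi_local : local_morphism mA mB phi)
  (* F is B / mA B *)
  (F : comNzRingType) (pF : {rmorphism B -> F})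
  (hF : is_quotient_by (ideal_gen (phi @` mA)) pF)
  (F_ci : complete_intersection F)
  (* k is the residue field of A *)
  (k : fieldType) (pk : {rmorphism A -> k}) (hk : is_quotient_by mA pk)
  (M : lmodType B) (M_finite : finite_type (restr phi M))
  (T0 T1 : lmodType A)
  (hT0 : is_Tor 0 (restr phi M) (restr pk k^o) T0)
  (hT1 : is_Tor 1 (restr phi M) (restr pk k^o) T1)
  (hle : (dim_over pk T1)%:Z <=
         ((edim mA)%:Z - (edim mB)%:Z) * (dim_over pk T0)%:Z) :
  free_module M /\
  (dim_over pk T1)%:Z = ((edim mA)%:Z - (edim mB)%:Z) * (dim_over pk T0)%:Z.
Proof.
have mAL := noetherian_local_units hA; have mBL := noetherian_local_units hB.
have [imA mA1 mAU] := mAL; have [imB mB1 mBU] := mBL.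
have [noeA _] := hA; have [noeB _] := hB.
pose J := ideal_gen (phi @` mA).
have iJ : ideal J := ideal_gen_ideal _.
have JmB : J `<=` mB by apply: (@span_min B B^o) => // _ [a ma <-]; apply: phi_local.
have [N mBN] := finite_fiber_nilpotent mAL mBL noeB hk phi_finite.
have [[x0 ex0] _] := min_generatorsP (noeB _ imB).
set f := edim mB in hle *; rewrite -/(edim mB) -/f in x0 ex0.
pose x : 'cV[B]_f := \col_i x0 i.
have mx i : mB (x i 0) by rewrite mxE [X in X _]ex0; apply: mem_span_range.
have xgen b : mB b -> exists c : 'rV_f, b = (c *m x) 0 0.
  rewrite {1}ex0 => /span_rangeP[c ->]; exists (\row_i c i); rewrite mxE.
  by apply: eq_bigr => i _; rewrite !mxE.
have [C [pi [a [piJ aP]]]] := exists_ci_matrix mBL JmB mBN hF F_ci mx xgen.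
have [b0 [g gP]] := fg_mod_basis mAL M_finite (@submodT _ _).
have gX := span_basis_full mAL M_finite gP.
pose K := [set v | lincomb g v = 0].
have sK : submod K := lincomb_ker_submod g.
have [b1 [kappa kP]] := fg_mod_basis mAL (row_submod_fg noeA sK) sK.
have [t tP] := edim_basis hA.
have dT0 := dim_Tor0 hk imA gP hT0.
have dT1 := dim_Tor1 hk imA gX gP kP hT1.
rewrite {}dT0 {}dT1 in hle *.
have [_ _ gind] := gP; have [t_m _ tind] := tP.
pose rel l := (a *m x) l 0.
have relJ l : J (rel l) := ci_rel_mem piJ aP l.
have rel_span b : J b -> exists c : 'I_f -> B, b = \sum_l c l * rel l.
  exact: (ci_rel_span mBL noeB iJ piJ JmB mx xgen aP).
have g_span (y : restr phi M) : exists c : 'I_b0 -> A, y = \sum_i c i *: g i.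
  by apply/span_rangeP; rewrite gX.
(* These f b0 products span JM, which is mA M, modulo J^2 M; they are the second family in the
   count. *)
pose w (p : 'I_f * 'I_b0) : restr phi M := rel p.1 *: (g p.2 : M).
have w_sum (c : 'I_f -> 'I_b0 -> A) :
    \sum_l rel l *: (\sum_i c l i *: g i : M) = \sum_p c p.1 p.2 *: w p :> M.
  rewrite -(pair_bigA _ (fun l i => c l i *: w (l, i))) /=; apply: eq_bigr => l _.
  rewrite scaler_sumr; apply: eq_bigr => i _.
  by rewrite !restr_scaleE /w /= !scalerA mulrC.
have sJM := smul_restr mA phi (@submodT B M).
have sJJM := smul_restr mA phi (@smul_submod B M J setT).
have [|||ecard [K_small w_indep]] := @count_equality A mA k pk hk imA (restr phi M) b0 b1 (edim mA) g kappa t _ w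
   gX gind kP t_m tind.
- by move=> p; rewrite sJM; apply: (@smulI B M) => //; apply: relJ.
- move=> y; rewrite sJM => /(smul_rel mBL noeB iJ piJ JmB mx xgen aP)[v ->].
  have /choice[c cP] l := g_span (v l).
  exists (fun p => c p.1 p.2).
  have e : \sum_l rel l *: v l = \sum_p c p.1 p.2 *: w p :> restr phi M.
    by rewrite -[RHS]w_sum; apply: eq_bigr => l _; rewrite -cP.
  rewrite [X in smul mA _ X](_ : _ = 0); first exact: submod0.
  exact: etrans (congr1 (fun z => z - _) e) (subrr _).
(* [hle] rearranged without subtraction: b1 + f b0 <= edim A b0. *)
- rewrite card_prod !card_ord; lia.
rewrite card_prod !card_ord in ecard.
split; last by lia.
(* Independence of the products forces the coordinates over A of each [v i] into mA. *)
have rel_inj (v : 'I_f -> M) : smul J (smul J setT) (\sum_l rel l *: v l) ->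
    forall l, smul J setT (v l).
  move=> hv l; have /choice[c cP] i := g_span (v i).
  have mc : forall p, mA (c p.1 p.2).
    apply: w_indep; rewrite sJM sJJM -w_sum.
    by under eq_bigr do rewrite -cP.
  rewrite -sJM cP; apply: (@submod_sum A (restr phi M)) => // i _.
  by apply: smulI => //; apply: (mc (l, i)).
have fM : finitely_generated [set: M].
  exists b0, g; apply/seteqP; split=> // y _; have [c ->] := g_span y.
  by apply/span_rangeP; exists (fun i => phi (c i)).
have [r [u uP]] := fg_mod_basis mBL fM (@submodT _ _).
have uM := span_basis_full mBL fM uP; have [_ _ uind] := uP.
have u_indep := @ci_free_mod B C mB J pi f x mBL noeB iJ piJ JmB mx xgen a aP M
  rel_inj N r u mBN uind.
exact: (free_of_ker_trivial mAL mBL noeB phi_finite phi_local uM g_span K_small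
  rel_span relJ rel_inj u_indep).
Qed.
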